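(* The three invariants $a_{12}$, $a_{03}$ and $b_3$ of cross caps in $\mathbf{R}^3$ are extrinsic: for each $I\in\{a_{12},a_{03},b_3\}$ there exists an isometric deformation $\{f_t\}_{|t|<\epsilon}$ of cross caps in $\mathbf{R}^3$ such that the value of $I$ for $f_t$ at the cross cap singularity $(0,0)$ is not constant in $t$.
   Context: A singular point $p$ of a $C^\infty$ map $f:U\to\mathbf{R}^3$ ($U\subset\mathbf{R}^2$ a domain) is a cross cap singularity if there are a local diffeomorphism $\varphi$ of $\mathbf{R}^2$ (taking $p$ to the origin) and a local diffeomorphism $\Phi$ of $\mathbf{R}^3$ (taking $f(p)$ to the origin) such that $\Phi\circ f=f_{\mathrm{std}}\circ\varphi$ near $p$, where $f_{\mathrm{std}}(u,v)=(u,uv,v^2)$. Normal form: at a cross cap singularity, for each $n\ge 3$, after an orientation-preserving isometry of $\mathbf{R}^3$ and an orientation-preserving local coordinate change of the domain (centered at the singular point), $f$ takes the form $$f(u,v)=\left(u,\;uv+\sum_{i=3}^n\frac{b_i}{i!}v^i,\;\sum_{r=2}^n\sum_{j=0}^r\frac{a_{j\,r-j}}{j!(r-j)!}u^jv^{r-j}\right)+O(u,v)^{n+1},\qquad a_{02}>0,$$ where $O(u,v)^{n+1}$ denotes terms of order at least $n+1$. The coefficients $a_{jk}$ and $b_i$ are then uniquely determined and are regarded as invariants of the cross cap $f$. An isometric deformation is a smooth $1$-parameter family of $C^\infty$ maps $f_t:U\to\mathbf{R}^3$ ($|t|<\epsilon$, $\epsilon>0$), $U\subset\mathbf{R}^2$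 a domain containing the origin, each having a cross cap singularity at $(0,0)$, such that for every $t$ one has on $U$: $(f_t)_u\cdot(f_t)_u=(f_0)_u\cdot(f_0)_u$, $(f_t)_u\cdot(f_t)_v=(f_0)_u\cdot(f_0)_v$, $(f_t)_v\cdot(f_t)_v=(f_0)_v\cdot(f_0)_v$. An invariant is called extrinsic if it can change under isometric deformation. *)

(* Defs.v *)
From HB Require Import structures.
From mathcomp Require Import all_boot all_order all_algebra.
From mathcomp Require Import all_classical all_reals all_analysis.

Set Implicit Arguments.
Unset Strict Implicit.
Unset Printing Implicit Defensive.

Import Order.TTheory GRing.Theory Num.Theory.
Import numFieldNormedType.Exports.
Local Open Scope classical_set_scope.
Local Open Scope ring_scope.

(* f is C^k in a neighbourhood of every point of the open set D. It is used only
   between finite-dimensional spaces, where asking for differentiability of all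
   iterated directional derivatives up to order k - 1 and continuity of those of
   order k is the usual notion. *)
Fixpoint Ck_on (R : realType) (V W : normedModType R) (k : nat) (D : set V)
    (f : V -> W) : Prop :=
  match k with
  | 0 => forall x, D x -> {for x, continuous f}
  | k'.+1 => (forall x, D x -> differentiable f x) /\
             (forall v, Ck_on k' D (fun x => 'D_v f x))
  end.

Definition smooth_on (R : realType) (V W : normedModType R) (D : set V)
    (f : V -> W) : Prop :=
  forall k, Ck_on k D f.

Definition local_diffeo (R : realType) (V W : normedModType R)
    (phi : V -> W) (p : V) : Prop :=
  exists (A : set V) (psi : W -> V),
    [/\ open A /\ A p,
        open (phi @` A),
        smooth_on A phi,
        smooth_on (phi @` A) psi
      & forall x, A x -> psi (phi x) = x].

Section CrossCaps.
Variable R : realType.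

Definition row3 (x y z : R) : 'rV[R]_3 := \row_(i < 3) [:: x; y; z]`_i.

Definition dot (x y : 'rV[R]_3) : R := \sum_(i < 3) x 0 i * y 0 i.

Definition ucoord (x : 'rV[R]_2) : R := x 0 0.
Definition vcoord (x : 'rV[R]_2) : R := x 0 1.

Definition partial_u (f : 'rV[R]_2 -> 'rV[R]_3) (x : 'rV[R]_2) : 'rV[R]_3 :=
  'D_(delta_mx 0 0) f x.
Definition partial_v (f : 'rV[R]_2 -> 'rV[R]_3) (x : 'rV[R]_2) : 'rV[R]_3 :=
  'D_(delta_mx 0 1) f x.

Definition f_std (x : 'rV[R]_2) : 'rV[R]_3 :=
  row3 (ucoord x) (ucoord x * vcoord x) (vcoord x ^+ 2).

Definition singular_point (f : 'rV[R]_2 -> 'rV[R]_3) (p : 'rV[R]_2) : Prop :=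
  (\rank ('J f p) < 2)%N.

Definition cross_cap (f : 'rV[R]_2 -> 'rV[R]_3) (p : 'rV[R]_2) : Prop :=
  singular_point f p /\
  exists (phi : 'rV[R]_2 -> 'rV[R]_2) (Phi : 'rV[R]_3 -> 'rV[R]_3),
    [/\ local_diffeo phi p /\ phi p = 0,
        local_diffeo Phi (f p) /\ Phi (f p) = 0
      & \forall x \near p, Phi (f x) = f_std (phi x)].

(* [coef_a c j k] is a_{jk} and [coef_b c i] is b_i. *)
Record coefs := Coefs { coef_a : nat -> nat -> R; coef_b : nat -> R }.

Definition normal_jet (n : nat) (c : coefs) (x : 'rV[R]_2) : 'rV[R]_3 :=
  let u := ucoord x in
  let v := vcoord x in
  row3 u
       (u * v + \sum_(3 <= i < n.+1) coef_b c i / i`!%:R * v ^+ i)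
       (\sum_(2 <= r < n.+1) \sum_(0 <= j < r.+1)
          coef_a c j (r - j) / (j`!%:R * (r - j)`!%:R) * u ^+ j * v ^+ (r - j)).

(* Vectors are rows: the orientation-preserving isometry of the target is
   y |-> y A + w with A in SO(3), and phi is the coordinate change. *)
Definition has_normal_form (n : nat) (f : 'rV[R]_2 -> 'rV[R]_3)
    (p : 'rV[R]_2) (c : coefs) : Prop :=
  0 < coef_a c 0 2 /\
  exists (A : 'M[R]_3) (w : 'rV[R]_3) (phi : 'rV[R]_2 -> 'rV[R]_2),
    [/\ A *m A^T = 1%:M /\ \det A = 1,
        local_diffeo phi 0 /\ phi 0 = p,
        0 < \det ('J phi 0)
      & (fun x => f (phi x) *m A + w - normal_jet n c x)
          =O_ (0 : 'rV[R]_2) (fun x => `|x| ^+ n.+1)].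

Inductive cc_invariant := Inv_a of nat & nat | Inv_b of nat.

Definition inv_order (I : cc_invariant) : nat :=
  match I with Inv_a j k => (j + k)%N | Inv_b i => i end.

Definition inv_coef (I : cc_invariant) (c : coefs) : R :=
  match I with Inv_a j k => coef_a c j k | Inv_b i => coef_b c i end.

(* x is the (uniquely determined) value of I for f at p: some normal form has the
   coefficient x, and every normal form does. The constraint on n makes the
   coefficient occur in the normal form of order n. *)
Definition inv_value (I : cc_invariant) (f : 'rV[R]_2 -> 'rV[R]_3)
    (p : 'rV[R]_2) (x : R) : Prop :=
  let adm n c := [/\ (3 <= n)%N, (inv_order I <= n)%N & has_normal_form n f p c] in
  (exists n c, adm n c /\ inv_coef I c = x) /\
  (forall n c, adm n c -> inv_coef I c = x).

(* Smoothness of the family is joint smoothness in (t, (u, v)). *)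
Definition isometric_deformation (eps : R) (U : set 'rV[R]_2)
    (f : R -> 'rV[R]_2 -> 'rV[R]_3) : Prop :=
  [/\ 0 < eps,
      [/\ open U, connected U & U 0],
      smooth_on [set tx : R^o * 'rV[R]_2 | `|tx.1| < eps /\ U tx.2]
                (fun tx => f tx.1 tx.2),
      (forall t, `|t| < eps -> smooth_on U (f t) /\ cross_cap (f t) 0)
    & forall t x, `|t| < eps -> U x ->
        [/\ dot (partial_u (f t) x) (partial_u (f t) x) =
              dot (partial_u (f 0) x) (partial_u (f 0) x),
            dot (partial_u (f t) x) (partial_v (f t) x) =
              dot (partial_u (f 0) x) (partial_v (f 0) x)
          & dot (partial_v (f t) x) (partial_v (f t) x) =
              dot (partial_v (f 0) x) (partial_v (f 0) x)]].

Definition extrinsic (I : cc_invariant) : Prop :=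
  exists (eps : R) (U : set 'rV[R]_2) (f : R -> 'rV[R]_2 -> 'rV[R]_3),
    isometric_deformation eps U f /\
    exists t1 t2 x1 x2,
      [/\ `|t1| < eps, `|t2| < eps,
          inv_value I (f t1) 0 x1, inv_value I (f t2) 0 x2 & x1 <> x2].

End CrossCaps.

(* Main.v *)
(* The surfaces are ruled: f = gamma(v) + u xi(v), where xi is a unit-speed circle
   of radius rho on the unit sphere, with frame e1 = xi, e2 = xi', e3 = e1 x e2,
   and gamma' = v (3/5 e2 + 4/5 e3).  The first fundamental form depends only on
   the coordinates of gamma' in that frame, not on the geodesic curvature
   kap = k / rho of xi, where rho^2 + k^2 = 1; so rho = cos t, k = sin t is an
   isometric deformation.  (The parameter u below is shifted by 3/5 v, which
   makes the formulas shorter.)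

   Each of these surfaces is a cross cap: its double curve can be written down in
   terms of the entire functions cos(sqrt s) and sin(sqrt s) / sqrt s, which gives
   both coordinate changes up to the inverse function theorem.  A polynomial
   coordinate change brings the surface into normal form with
   b_3 = - 125/32 kap, a_12 = 125/64 kap, a_03 = 1125/256 kap.  That these numbers
   do not depend on the chosen normal form follows by comparing two normal forms
   along the rays r -> r (al, eta) as r tends to 0, which needs only that the
   coordinate change between them is differentiable at 0. *)

Require Import Defs.
From HB Require Import structures.
From mathcomp Require Import all_boot all_order all_algebra.
From mathcomp Require Import all_classical all_reals all_analysis.
From mathcomp Require Import ring lra.

Set Implicit Arguments.
Unset Strict Implicit.
Unset Printing Implicit Defensive.

Import Order.TTheory GRing.Theory Num.Theory.
Import numFieldNormedType.Exports.
Local Open Scope classical_set_scope.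
Local Open Scope ring_scope.

(** * Calculus of C^k maps *)

(** For a general angle, gamma' = v (c e2 + s e3) with c^2 + s^2 = 1, the same computation gives b_3
    = -2 kap/s^3, a_12 = kap/s^3 and a_03 = 3 c kap/s^4. So s must not vanish for the origin to be a
    cross cap, and c must not vanish for a_03 to vary; (3/5, 4/5) is a rational point of the unit
    circle with both properties. The cross cap condition asks for genuine diffeomorphisms, not jets.
    In general this means splitting functions into parts even and odd in a variable q and writing
    even functions smoothly in q^2. For a circle everything is built from cos q and sin q, whose
    dependence on q^2 is explicit, so the splitting can be done by hand. In the uniqueness argument
    the unknown coordinate change is never expanded beyond first order: the equations of the first
    two components control its second-order part along each ray, which suffices to compare the cubic
    terms of the third component. *)

Section SmoothCalculus.
Variable R : realType.
Implicit Types (V W : normedModType R).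

Lemma is_diff_norm V W (f : V -> W) (x : V) (df : {linear V -> W}) :
  continuous df ->
  (forall e, 0 < e -> \forall h \near (0 : V), `|f (h + x) - f x - df h| <= e * `|h|) ->
  is_diff x f df.
Proof.
move=> dc H.
have E : f \o shift x = cst (f x) + df +o_ 0 id.
  apply/eqaddoP => e e0; apply: filterS (H e e0) => h /=.
  rewrite /= /shift; rewrite !fctE; rewrite opprD addrA. exact.
have D := diff_unique dc E.
by constructor => //; apply/diff_locallyP; rewrite D.
Qed.

Lemma diff_norm V W (f : V -> W) (x : V) : differentiable f x ->
  forall e, 0 < e -> \forall h \near (0 : V), `|f (h + x) - f x - 'd f x h| <= e * `|h|.
Proof.
move=> /diff_locally fx e e0.
have /eqaddoP/(_ e e0) := fx.
by apply: filterS => h /=; rewrite !fctE opprD addrA.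
Qed.

Lemma near_eq_differentiable V W (f g : V -> W) (x : V) :
  (\near x, f x = g x) -> differentiable f x -> differentiable g x.
Proof.
move=> fg fx; suff : is_diff x g ('d f x) by move=> [].
apply: is_diff_norm; first exact: diff_continuous.
move=> e e0; have H := diff_norm fx e0.
have fg0 : \forall h \near (0 : V), f (h + x) = g (h + x).
  by move: fg; rewrite (near_shift 0 x); apply: filterS => h /=; rewrite subr0.
near=> h; rewrite -(nbhs_singleton fg) -(near fg0 h) //.
by near: h.
Unshelve. all: by end_near. Qed.

Lemma open_near V (D : set V) (P : V -> Prop) x : open D -> D x ->
  (forall y, D y -> P y) -> \forall y \near x, P y.
Proof. by move=> oD Dx DP; apply: filterS (open_nbhs_nbhs (conj oD Dx)). Qed.

(** Formulas for directional derivatives are known on [D] only; this lets the closure lemmas below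
    substitute them. Openness makes equality on [D] an equality near each point, hence one of
    derivatives. *)
Lemma Ck_on_eq V W k (D : set V) (f g : V -> W) : open D ->
  (forall x, D x -> f x = g x) -> Ck_on k D f -> Ck_on k D g.
Proof.
move=> oD; elim: k f g => [|k IH] f g fg /=.
  move=> fc x Dx; rewrite /prop_for /continuous_at -(fg x Dx).
  by apply: cvg_trans (fc x Dx); apply: near_eq_cvg; exact: open_near fg.
move=> [fd fk]; split=> [x Dx|v].
  by apply: near_eq_differentiable (fd x Dx); exact: open_near fg.
apply: IH (fk v) => x Dx.
by apply: near_eq_derive; exact: open_near fg.
Qed.

Lemma Ck_onW V W k (D : set V) (f : V -> W) : Ck_on k.+1 D f -> Ck_on k D f.
Proof.
elim: k f => [|k IH] f /= [fd fk]; last by split=> // v; apply: IH; exact: fk.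
by move=> x Dx; apply: differentiable_continuous; exact: fd.
Qed.

Lemma Ck_on_sub V W k (D E : set V) (f : V -> W) :
  E `<=` D -> Ck_on k D f -> Ck_on k E f.
Proof.
move=> ED; elim: k f => [|k IH] f /=; first by move=> fc x /ED; exact: fc.
by move=> [fd fk]; split=> [x /ED|v]; [exact: fd|exact/IH/fk].
Qed.

Lemma Ck_on_cst V W k (D : set V) (w : W) : Ck_on k D (fun=> w).
Proof.
elim: k w => [|k IH] w /=; first by move=> x _; exact: cst_continuous.
split=> [x _|v]; first exact: differentiable_cst.
by rewrite [X in Ck_on k D X](_ : _ = fun=> 0)//; apply/funext => x; rewrite derive_cst.
Qed.

Lemma Ck_on_lin V W k (D : set V) (f : {linear V -> W}) :
  continuous f -> Ck_on k D f.
Proof.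
move=> fc; case: k => [|k] /=; first by move=> x _; exact: fc.
have fd x : differentiable f x by exact: linear_differentiable.
split=> [x _|v]; first exact: fd.
rewrite [X in Ck_on k D X](_ : _ = fun=> f v); first exact: Ck_on_cst.
by apply/funext => x; rewrite deriveE// diff_lin.
Qed.

Lemma Ck_onD V W k (D : set V) (f g : V -> W) : open D ->
  Ck_on k D f -> Ck_on k D g -> Ck_on k D (fun x => f x + g x).
Proof.
move=> oD; elim: k f g => [|k IH] f g /=.
  by move=> fc gc x Dx; apply: continuousD; [exact: fc|exact: gc].
move=> [fd fk] [gd gk]; split=> [x Dx|v].
  by apply: differentiableD; [exact: fd|exact: gd].
apply: Ck_on_eq oD _ (IH _ _ (fk v) (gk v)) => x Dx.
by rewrite deriveD//; apply: diff_derivable; [exact: fd|exact: gd].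
Qed.

Lemma Ck_on_sum V W k (D : set V) (I : Type) (r : seq I) (P : pred I) (F : I -> V -> W) :
  open D -> (forall i, P i -> Ck_on k D (F i)) ->
  Ck_on k D (fun x => \sum_(i <- r | P i) F i x).
Proof.
move=> oD FC; elim: r => [|i r IH].
  by apply: Ck_on_eq oD _ (Ck_on_cst k D (0 : W)) => x _; rewrite big_nil.
case: (boolP (P i)) => Pi.
  by apply: Ck_on_eq oD _ (Ck_onD oD (FC i Pi) IH) => x _; rewrite big_cons Pi.
by apply: Ck_on_eq oD _ IH => x _; rewrite big_cons (negbTE Pi).
Qed.

Lemma is_derive_comp_lin V W (X : normedModType R) (f : V -> W) (L : {linear W -> X}) x v :
  continuous L -> differentiable f x ->
  differentiable (fun y => L (f y)) x /\ 'D_v (fun y => L (f y)) x = L ('D_v f x).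
Proof.
move=> cL fd; have Ld y : differentiable L y by exact: linear_differentiable.
have d1 : differentiable (fun y => L (f y)) x.
  exact: (@differentiable_comp _ _ _ _ f L).
split=> //.
by rewrite deriveE// (@diff_comp _ _ _ _ f L)//= diff_lin// deriveE.
Qed.

Lemma Ck_on_comp_lin V W (X : normedModType R) k (D : set V) (f : V -> W)
    (L : {linear W -> X}) : open D -> continuous L ->
  Ck_on k D f -> Ck_on k D (fun x => L (f x)).
Proof.
move=> oD cL; elim: k f => [|k IH] f /=.
  by move=> fc x Dx; apply: continuous_comp; [exact: fc|exact: cL].
move=> [fd fk]; split=> [x Dx|v].
  by have [] := is_derive_comp_lin 0 cL (fd x Dx).
apply: Ck_on_eq oD _ (IH _ (fk v)) => x Dx.
by have [_ ->] := is_derive_comp_lin v cL (fd x Dx).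
Qed.

Lemma scaler_is_bilinear V :
  bilinear_for
    (GRing.Scale.Law.clone _ _ *:%R _) (GRing.Scale.Law.clone _ _ *:%R _)
    (@GRing.scale R V : R -> V -> V).
Proof.
split=> [u'|u] a x y /=.
- by rewrite scalerDl scalerA.
- by rewrite scalerDr !scalerA mulrC.
Qed.
HB.instance Definition _ V := bilinear_isBilinear.Build R R V V _ _
  (@GRing.scale R V : R -> V -> V) (@scaler_is_bilinear V).

Lemma is_diff_scale V W (a : V -> R) (f : V -> W) x :
  differentiable a x -> differentiable f x ->
  is_diff x (fun y => a y *: f y) (fun h => a x *: 'd f x h + 'd a x h *: f x).
Proof.
move=> da df.
have sc : continuous (fun p : R * W => p.1 *: p.2).
  by move=> p; apply: scale_continuous.
have db := @differentiable_bilin _ _ _ _ (@GRing.scale R W : {bilinear R -> W -> W}) (a x, f x) sc.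
have dp := differentiable_pair da df.
constructor.
  exact: (@differentiable_comp _ _ _ _ (fun y => (a y, f y)) (fun p => p.1 *: p.2)).
rewrite (@diff_comp _ _ _ _ (fun y => (a y, f y)) (fun p => p.1 *: p.2))//.
have -> := @diff_bilin _ _ _ _ (@GRing.scale R W : {bilinear R -> W -> W}) (a x, f x) sc.
by apply/funext => h /=; rewrite diff_pair.
Qed.

Lemma Ck_onZ V W k (D : set V) (a : V -> R) (f : V -> W) : open D ->
  Ck_on k D a -> Ck_on k D f -> Ck_on k D (fun x => a x *: f x).
Proof.
move=> oD; elim: k a f => [|k IH] a f.
  move=> /= ac fc x Dx.
  by apply: continuousZ; [exact: ac|exact: fc].
move=> aC fC; have [ad ak] := aC; have [fd fk] := fC.
have H x : D x -> is_diff x (fun y => a y *: f y) (fun h => a x *: 'd f x h + 'd a x h *: f x).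
  by move=> Dx; apply: is_diff_scale; [exact: ad|exact: fd].
split=> [x Dx|v]; first by case: (H x Dx).
(* Each term of the product rule pairs a derivative with an undifferentiated factor, whose class is
   lowered by one to match. *)
have := Ck_onD oD (IH _ _ (Ck_onW aC) (fk v)) (IH _ _ (ak v) (Ck_onW fC)).
apply: Ck_on_eq oD _ => x Dx; have [d1 d2] := H x Dx.
by rewrite [RHS]deriveE// d2 (deriveE _ (fd x Dx)) (deriveE _ (ad x Dx)).
Qed.

(* Finite-dimensionality of the middle space is expressed by the coordinates c and
   the basis e: the direction of differentiation of g moves with x. *)
Lemma Ck_on_comp V (M : normedModType R) W n (c : 'I_n -> {linear M -> R})
    (e : 'I_n -> M) k (D : set V) (E : set M) (f : V -> M) (g : M -> W) :
  (forall i, continuous (c i)) -> (forall y, y = \sum_i c i y *: e i) ->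
  open D -> (forall x, D x -> E (f x)) ->
  Ck_on k D f -> Ck_on k E g -> Ck_on k D (fun x => g (f x)).
Proof.
move=> cc ce oD DE; elim: k g => [|k IH] g.
  by move=> /= fc gc x Dx; apply: continuous_comp; [exact: fc|exact/gc/DE].
move=> fC gC; have [fd fk] := fC; have [gd gk] := gC.
have D1 x : D x -> differentiable (fun x => g (f x)) x.
  by move=> Dx; apply: (@differentiable_comp _ _ _ _ f g); [exact: fd|exact/gd/DE].
split=> // v.
have : Ck_on k D (fun x => \sum_i c i ('D_v f x) *: 'D_(e i) g (f x)).
  apply: Ck_on_sum => // i _; apply: Ck_onZ => //.
    by apply: Ck_on_comp_lin => //; exact: fk.
  by apply: (IH (fun y => 'D_(e i) g y)); [exact: Ck_onW|exact: gk].
apply: Ck_on_eq oD _ => x Dx.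
rewrite [RHS]deriveE; last exact: D1.
rewrite (@diff_comp _ _ _ _ f g)/=; [|exact: fd|exact/gd/DE].
rewrite (deriveE v (fd x Dx)) [in RHS](ce ('d f x v)) linear_sum.
apply: eq_bigr => i _; rewrite linearZ; congr (_ *: _).
by rewrite deriveE//; exact/gd/DE.
Qed.

Definition rcoord n (j : 'I_n) (x : 'rV[R]_n) : R := x 0 j.

Lemma rcoord_is_linear n (j : 'I_n) : linear (@rcoord n j).
Proof. by move=> a x y; rewrite /rcoord !mxE. Qed.
HB.instance Definition _ n (j : 'I_n) :=
  GRing.isLinear.Build R 'rV[R]_n R _ (@rcoord n j) (@rcoord_is_linear n j).

Lemma rcoord_continuous n (j : 'I_n) : continuous (@rcoord n j).
Proof. exact: coord_continuous. Qed.

Lemma rcoord_basis n (x : 'rV[R]_n) : x = \sum_j rcoord j x *: delta_mx 0 j.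
Proof. exact: row_sum_delta. Qed.

Lemma Ck_on_comp_rV V W n k (D : set V) (E : set 'rV[R]_n) (f : V -> 'rV[R]_n)
    (g : 'rV[R]_n -> W) :
  open D -> (forall x, D x -> E (f x)) ->
  Ck_on k D f -> Ck_on k E g -> Ck_on k D (fun x => g (f x)).
Proof.
apply: (@Ck_on_comp _ _ _ n (@rcoord n) (fun j => delta_mx 0 j)).
  exact: rcoord_continuous.
exact: rcoord_basis.
Qed.

Lemma Ck_on_comp_R V W k (D : set V) (E : set R) (f : V -> R) (g : R -> W) :
  open D -> (forall x, D x -> E (f x)) ->
  Ck_on k D f -> Ck_on k E g -> Ck_on k D (fun x => g (f x)).
Proof.
apply: (@Ck_on_comp _ _ _ 1%N (fun=> idfun) (fun=> 1)).
  by move=> _ x; exact: cvg_id.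
by move=> y; rewrite big_ord1 /= [_ *: _]mulr1.
Qed.

Lemma Ck_on_rV V n k (D : set V) (f : V -> 'rV[R]_n) : open D ->
  (forall j, Ck_on k D (fun x => f x 0 j)) -> Ck_on k D f.
Proof.
move=> oD H.
have : Ck_on k D (fun x => \sum_j f x 0 j *: delta_mx 0 j : 'rV[R]_n).
  by apply: Ck_on_sum => // j _; apply: Ck_onZ => //; exact: Ck_on_cst.
by apply: Ck_on_eq oD _ => x _; rewrite -row_sum_delta.
Qed.

Lemma Ck_on_coord V n k (D : set V) (f : V -> 'rV[R]_n) j : open D ->
  Ck_on k D f -> Ck_on k D (fun x => f x 0 j).
Proof.
move=> oD fC; exact: (Ck_on_comp_lin oD (@rcoord_continuous n j) fC).
Qed.

Lemma Ck_onM V k (D : set V) (f g : V -> R) : open D ->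
  Ck_on k D f -> Ck_on k D g -> Ck_on k D (fun x => f x * g x).
Proof. exact: Ck_onZ. Qed.

Lemma Ck_onN V W k (D : set V) (f : V -> W) : open D ->
  Ck_on k D f -> Ck_on k D (fun x => - f x).
Proof.
move=> oD fC; apply: (Ck_on_eq oD _ (Ck_onZ oD (Ck_on_cst k D (-1 : R)) fC)).
by move=> x _; rewrite scaleN1r.
Qed.

Lemma Ck_onB V W k (D : set V) (f g : V -> W) : open D ->
  Ck_on k D f -> Ck_on k D g -> Ck_on k D (fun x => f x - g x).
Proof. by move=> oD fC gC; apply: Ck_onD => //; exact: Ck_onN. Qed.

Lemma Ck_onX V k (D : set V) (f : V -> R) m : open D ->
  Ck_on k D f -> Ck_on k D (fun x => f x ^+ m).
Proof.
move=> oD fC; elim: m => [|m IH].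
  by apply: Ck_on_eq oD _ (Ck_on_cst k D (1 : R)) => x _; rewrite expr0.
by apply: Ck_on_eq oD _ (Ck_onM oD fC IH) => x _; rewrite exprS.
Qed.

Lemma Ck_on_prod V k (D : set V) (I : Type) (r : seq I) (F : I -> V -> R) :
  open D -> (forall i, Ck_on k D (F i)) ->
  Ck_on k D (fun x => \prod_(i <- r) F i x).
Proof.
move=> oD FC; elim: r => [|i r IH].
  by apply: Ck_on_eq oD _ (Ck_on_cst k D (1 : R)) => x _; rewrite big_nil.
by apply: Ck_on_eq oD _ (Ck_onM oD (FC i) IH) => x _; rewrite big_cons.
Qed.

(** The derivative is a polynomial in the function itself, so the induction on [k] closes. *)
Lemma Ck_on_inv k : Ck_on k [set x : R | x != 0] (fun x => x^-1).
Proof.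
have oN : open [set x : R | x != 0].
  have -> : [set x : R | x != 0] = ~` [set 0 : R].
    by apply/seteqP; split=> x /eqP.
  exact/closed_openC/closed_eq.
have Dinv x v : x != 0 -> 'D_v (fun x : R => x^-1) x = - v * (x^-1 * x^-1).
  move=> x0; rewrite (@deriveV _ _ id x v x0)//.
  by rewrite derive_id scaleNr [_ *: _]mulrC mulNr -exprVn.
elim: k => [|k IH]; first by move=> x /= x0; exact: inv_continuous.
split=> [x x0|v]; first exact: (@differentiableV _ _ id x).
have := Ck_onM oN (Ck_on_cst k _ (- v)) (Ck_onM oN IH IH).
by apply: Ck_on_eq oN _ => x /= x0; rewrite Dinv.
Qed.

Lemma Ck_onV V k (D : set V) (f : V -> R) : open D ->
  (forall x, D x -> f x != 0) ->
  Ck_on k D f -> Ck_on k D (fun x => (f x)^-1).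
Proof. by move=> oD f0 fC; apply: Ck_on_comp_R oD f0 fC (Ck_on_inv k). Qed.

(** The two functions are treated together because each is the derivative of the other up to
    sign. *)
Lemma Ck_on_sin_cos k (D : set R) :
  Ck_on k D (@sin R) /\ Ck_on k D (@cos R).
Proof.
suff [] : Ck_on k setT (@sin R) /\ Ck_on k setT (@cos R).
  by move=> s c; split; [move: s|move: c]; apply: Ck_on_sub.
elim: k => [|k [IHs IHc]].
  by split=> x _; [exact: continuous_sin|exact: continuous_cos].
have dE (f : R -> R) (x v df : R) : is_derive x 1 f df -> 'D_v f x = v * df.
  move=> fd; have fx : differentiable f x by apply/derivable1_diffP.
  by rewrite deriveE// diff1E// derive1E derive_val.
split; split.
- by move=> x _; apply/derivable1_diffP.
- move=> v; apply: Ck_on_eq openT _ (Ck_onM openT (Ck_on_cst k _ v) IHc) => x _.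
  by rewrite (dE _ _ _ _ (is_derive_sin x)).
- by move=> x _; apply/derivable1_diffP.
- move=> v; apply: Ck_on_eq openT _ (Ck_onM openT (Ck_on_cst k _ (- v)) IHs) => x _.
  by rewrite (dE _ _ _ _ (is_derive_cos x)) mulrN mulNr.
Qed.
End SmoothCalculus.

(** * The inverse function theorem *)

Section MeanValue.
Variable R : realType.
Implicit Types (V W : normedModType R).

Lemma rV_norm_coord n (x : 'rV[R]_n) j : `|x 0 j| <= `|x|.
Proof.
rewrite [leRHS]/Num.Def.normr/= mx_normrE.
by apply: (le_trans _ (le_bigmax _ _ (0, j))).
Qed.

Lemma rV_norm_le n (x : 'rV[R]_n) e : 0 <= e -> (forall j, `|x 0 j| <= e) -> `|x| <= e.
Proof.
move=> e0 H; rewrite /Num.Def.normr/= mx_normrE (bigmax_le _ e0)//= => -[i j] _ /=.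
by rewrite ord1.
Qed.

Lemma linear_rV_continuous n W (f : {linear 'rV[R]_n -> W}) : continuous f.
Proof.
rewrite (_ : (f : _ -> _) = fun x => \sum_j rcoord j x *: f (delta_mx 0 j)).
  have H := @Ck_on_sum R _ W 0 setT 'I_n (index_enum 'I_n) xpredT
    (fun j (x : 'rV[R]_n) => rcoord j x *: f (delta_mx 0 j)) openT _.
  move=> x; apply: H => //= j _; apply: (@Ck_onZ R _ W 0 _ _ _ openT).
    by move=> y _; exact: rcoord_continuous.
  exact: Ck_on_cst.
apply/funext => x; rewrite {1}(rcoord_basis x) linear_sum.
by apply: eq_bigr => j _; rewrite linearZ.
Qed.

Lemma mulmx_norm_le n m (M : 'M[R]_(n, m)) :
  exists2 C, 0 < C & forall x : 'rV[R]_n, `|x *m M| <= C * `|x|.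
Proof. exact: (linear_lipschitz (@linear_rV_continuous n _ (mulmxr M))). Qed.

Lemma deriveE_delta n W (f : 'rV[R]_n -> W) x v : differentiable f x ->
  'D_v f x = \sum_i v 0 i *: 'D_(delta_mx 0 i) f x.
Proof.
move=> fx; rewrite deriveE// {1}(rcoord_basis v) linear_sum.
by apply: eq_bigr => i _; rewrite linearZ deriveE.
Qed.

Lemma derive_coord V n (f : V -> 'rV[R]_n) x v j : differentiable f x ->
  'D_v (fun y => f y 0 j) x = ('D_v f x) 0 j.
Proof. by move=> fx; rewrite derive_mx ?mxE//; exact: diff_derivable. Qed.

Lemma jacobianE n m (f : 'rV[R]_n -> 'rV[R]_m) x i j : differentiable f x ->
  'J f x i j = ('D_(delta_mx 0 i) f x) 0 j.
Proof. by move=> fx; rewrite deriveEjacobian// -rowE [RHS]mxE. Qed.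

(** The mean value theorem is applied to each coordinate along the segment from y to x, which stays
    in the ball by convexity. The factor [n] counts the partial derivatives that make up the
    directional one. *)
Lemma ball_lipschitz n m (f : 'rV[R]_n -> 'rV[R]_m) (p : 'rV[R]_n) (r e : R) :
  (forall x : 'rV[R]_n, ball p r x -> differentiable f x) ->
  (forall (x : 'rV[R]_n) i j, ball p r x -> `|('D_(delta_mx 0 i) f x) 0 j| <= e) -> 0 <= e ->
  forall x y : 'rV[R]_n, ball p r x -> ball p r y -> `|f x - f y| <= n%:R * e * `|x - y|.
Proof.
move=> fd fe e0 x y Bx By.
apply: rV_norm_le => [|j]; first by rewrite !mulr_ge0// ler0n.
pose l (s : R) : 'rV[R]_n := s *: (x - y) + y.
have Bl (s : R) : 0 <= s <= 1 -> ball p r (l s).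
  move=> /andP[s0 s1]; move: Bx By; rewrite -!ball_normE /= => Bx By.
  have -> : p - l s = s *: (p - x) + (1 - s) *: (p - y).
    by apply/rowP => i; rewrite /l !mxE; ring.
  apply: le_lt_trans (ler_normD _ _) _; rewrite !normrZ !ger0_norm ?subr_ge0//.
  have [->|sn0] := eqVneq s 0; first by rewrite mul0r add0r subr0 mul1r.
  have : 0 < s by rewrite lt_neqAle eq_sym sn0.
  nra.
pose g (s : R) : R := (f (l s)) 0 j.
have ld (s : R) : is_derive s (1 : R) l (x - y).
  have [d1 d2] : is_diff s l (( *:%R ^~ (x - y)) + 0).
    exact: (@is_diffD R R 'rV[R]_n ( *:%R ^~ (x - y)) (cst y)).
  apply: DeriveDef; first exact: diff_derivable.
  by rewrite deriveE// d2 addr0 scale1r.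
have gd (s : R) : 0 <= s <= 1 -> is_derive s (1 : R) g ('D_(x - y) f (l s) 0 j).
  move=> s01.
  have d1 : differentiable l s by apply/derivable1_diffP; exact: (ex_derive).
  have d2 : differentiable (fun s => f (l s)) s.
    by apply: (@differentiable_comp _ _ _ _ l f) => //; exact/fd/Bl.
  apply: DeriveDef.
    by apply/diff_derivable/(@differentiable_comp _ _ _ _ (fun s => f (l s)) (@rcoord R m j)) => //; exact: linear_differentiable (@rcoord_continuous R m j).
  have E1 : 'D_1 g s = ('D_1 (fun s : R => f (l s)) s) 0 j by exact: derive_coord.
  rewrite E1 (deriveE _ d2) (@diff_comp _ _ _ _ l f _ d1 (fd _ (Bl s s01)))/=.
  by rewrite -(deriveE _ d1) derive_val (deriveE _ (fd _ (Bl s s01))).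
have gc : {within `[0, 1], continuous g}.
  apply: derivable_within_continuous => s; rewrite in_itv /= => s01.
  by have := gd s s01; case.
have gd' (s : R) : s \in `]0, 1[ -> is_derive s (1 : R) g ('D_(x - y) f (l s) 0 j).
  by rewrite in_itv /= => /andP[s0 s1]; apply: gd; rewrite !ltW.
have [c] := MVT_segment ler01 gd' gc.
rewrite in_itv /= => c01; rewrite subr0 mulr1 => E.
have -> : (f x - f y) 0 j = g 1 - g 0.
  by rewrite /g /l scale1r subrK scale0r add0r !mxE.
rewrite E deriveE_delta; last exact/fd/Bl.
rewrite summxE; apply: le_trans (ler_norm_sum _ _ _) _.
have -> : n%:R * e * `|x - y| = \sum_(i < n) (e * `|x - y|).
  by rewrite sumr_const card_ord -mulrA mulr_natl.
apply: ler_sum => i _; rewrite mxE normrM mulrC ler_pM//.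
  by apply: fe; exact: Bl.
exact: rV_norm_coord.
Qed.

End MeanValue.

(** Completeness is what the contraction principle in [perturbation_surj] requires. *)
HB.instance Definition _ (R : realType) n := Complete.on 'rV[R]_n.

Section InverseFunctionTheorem.
Variable R : realType.
Implicit Types (V W : normedModType R).

Lemma Ck_on_det V n k (D : set V) (M : V -> 'M[R]_n) : open D ->
  (forall i j, Ck_on k D (fun x => M x i j)) -> Ck_on k D (fun x => \det (M x)).
Proof.
move=> oD MC; apply: (@Ck_on_sum _ _ R) => // s _; apply: Ck_onM => //.
  exact: Ck_on_cst.
exact: Ck_on_prod.
Qed.

(** Cramer's rule: an entry of the inverse is a cofactor divided by the determinant. *)
Lemma Ck_on_invmx V n k (D : set V) (M : V -> 'M[R]_n) i j : open D ->
  (forall x, D x -> \det (M x) != 0) ->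
  (forall i j, Ck_on k D (fun x => M x i j)) -> Ck_on k D (fun x => invmx (M x) i j).
Proof.
move=> oD d0 MC.
have adjC : Ck_on k D (fun x => (-1) ^+ (j + i) * \det (row' j (col' i (M x))) : R).
  apply: Ck_onM => //; first exact: (Ck_on_cst k D ((-1) ^+ (j + i) : R)).
  apply: Ck_on_det => // a b.
  by apply: Ck_on_eq oD _ (MC (lift j a) (lift i b)) => x _; rewrite !mxE.
apply: Ck_on_eq oD _ (Ck_onM oD (Ck_onV oD d0 (Ck_on_det oD MC)) adjC) => x Dx.
by rewrite /invmx unitmxE unitfE d0// !mxE.
Qed.

Section Inverse.
Variables (n : nat) (A : set 'rV[R]_n) (F psi : 'rV[R]_n -> 'rV[R]_n) (K : R).
Hypotheses (oA : open A) (oFA : open (F @` A)) (FC : smooth_on A F).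
Hypotheses (psiK : forall x, A x -> psi (F x) = x).
Hypotheses (detF : forall x, A x -> \det ('J F x) != 0).
Hypotheses (K0 : 0 < K).
Hypotheses (FK : forall x y, A x -> A y -> `|x - y| <= K * `|F x - F y|).

Let FAK y : (F @` A) y -> F (psi y) = y.
Proof. by move=> [x Ax <-]; rewrite psiK. Qed.

Let psiA y : (F @` A) y -> A (psi y).
Proof. by move=> [x Ax <-]; rewrite psiK. Qed.

(** With h the increment of [psi] for an increment k of y, the error for [psi] is the error of [F]
    at h multiplied by - J^-1. It is o(h), and h = O(k) by the bound [FK]. *)
Lemma inverse_is_diff y : (F @` A) y ->
  is_diff y psi (mulmxr (invmx ('J F (psi y)))).
Proof.
move=> yFA; have Ax := psiA yFA; have Fx := FAK yFA.
set x := psi y in Ax Fx *; set J := 'J F x.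
have Ju : J \in unitmx by rewrite unitmxE unitfE detF.
have [Fd _] := FC 1.
have [C C0 HC] := mulmx_norm_le (invmx J).
apply: is_diff_norm; first exact: linear_rV_continuous.
move=> e e0.
pose e1 := e / (C * K); have e10 : 0 < e1 by rewrite divr_gt0// mulr_gt0.
have /nbhs_ballP[d d0 Hd] := diff_norm (Fd x Ax) e10.
have : \forall k \near (0 : 'rV[R]_n), (F @` A) (k + y).
  have : \forall k \near y, (F @` A) k by exact: open_near yFA _.
  rewrite (near_shift 0 y).
  by apply: filterS => k /=; rewrite subr0.
have : \forall k \near (0 : 'rV[R]_n), `|k| < d / K.
  exact/nbhs0_lt/divr_gt0.
move=> Hs Hb; near=> k.
have ky : (F @` A) (k + y) by near: k.
have kd : `|k| < d / K by near: k.
pose h := psi (k + y) - x.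
have hk : `|h| <= K * `|k|.
  apply: le_trans (FK (psiA ky) Ax) _.
  by rewrite FAK// Fx addrK.
have hd : ball 0 d h.
  rewrite -ball_normE /= sub0r normrN; apply: le_lt_trans hk _.
  by rewrite mulrC -ltr_pdivlMr.
have := Hd h hd; rewrite /= /h subrK FAK// Fx addrK -/h => H.
have -> : psi (k + y) - x - k *m invmx J = - ((k - 'd F x h) *m invmx J).
  rewrite -deriveE; last exact: Fd.
  rewrite deriveEjacobian; last exact: Fd.
  by rewrite mulmxBl mulmxK// opprB.
rewrite normrN; apply: le_trans (HC _) _.
apply: le_trans (_ : C * (e1 * (K * `|k|)) <= _).
  rewrite ler_pM2l//; apply: le_trans H _.
  by rewrite ler_pM2l.
rewrite le_eqVlt; apply/orP; left; apply/eqP.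
by rewrite /e1; field; rewrite !gt_eqF.
Unshelve. all: by end_near. Qed.

(** Bootstrapping: the derivative of [psi] is the inverse Jacobian of [F] evaluated at [psi], so it
    is as regular as [psi] itself and each round gains one order. *)
Lemma inverse_smooth : smooth_on (F @` A) psi.
Proof.
elim=> [|k IH].
  move=> y yFA; have [d _] := inverse_is_diff yFA; exact: differentiable_continuous.
split=> [y yFA|v]; first by have [] := inverse_is_diff yFA.
have JC i j : Ck_on k (F @` A) (fun y => 'J F (psi y) i j).
  have [Fd Fk] := FC k.+1.
  have := Ck_on_comp_rV oFA psiA IH (Ck_on_coord j oA (Fk (delta_mx 0 i))).
  apply: Ck_on_eq oFA _ => y yFA /=.
  by rewrite jacobianE//; exact/Fd/psiA.
have invC i j : Ck_on k (F @` A) (fun y => invmx ('J F (psi y)) i j).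
  by apply: Ck_on_invmx => // y yFA; exact/detF/psiA.
have : Ck_on k (F @` A) (fun y => v *m invmx ('J F (psi y))).
  apply: Ck_on_rV => // j.
  have := @Ck_on_sum R _ R k (F @` A) 'I_n (index_enum 'I_n) xpredT
    (fun i y => v 0 i * invmx ('J F (psi y)) i j) oFA.
  have H i : true -> Ck_on k (F @` A) (fun y => v 0 i * invmx ('J F (psi y)) i j).
    by move=> _; apply: Ck_onM => //; exact: (Ck_on_cst k _ (v 0 i)).
  by move=> /(_ H); apply: Ck_on_eq oFA _ => y _; rewrite mxE.
apply: Ck_on_eq oFA _ => y yFA.
by have [d1 d2] := inverse_is_diff yFA; rewrite deriveE// d2.
Qed.
End Inverse.

(** A solution is a fixed point of x |-> y - H x, a contraction of the closed ball of radius [e]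
    about x0. The ball is preserved because the distance of y and the variation of [H] each cost at
    most e/2. *)
Lemma perturbation_surj n (H : 'rV[R]_n -> 'rV[R]_n) (x0 y : 'rV[R]_n) (e : R) :
  0 < e ->
  (forall x x', `|x - x0| <= e -> `|x' - x0| <= e -> `|H x - H x'| <= 2^-1 * `|x - x'|) ->
  `|y - (x0 + H x0)| <= 2^-1 * e ->
  exists2 x, `|x - x0| <= e & x + H x = y.
Proof.
move=> e0 HL ye.
pose U := [set x : 'rV[R]_n | `|x - x0| <= e].
pose T (x : 'rV[R]_n) : 'rV[R]_n := y - H x.
have Ux0 : U x0 by rewrite /U /= subrr normr0 ltW.
have TU : set_fun U U T.
  move=> x Ux; rewrite /U /T /=.
  have -> : y - H x - x0 = (y - (x0 + H x0)) + (H x0 - H x).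
    by apply/rowP => i; rewrite !mxE; ring.
  apply: le_trans (ler_normD _ _) _.
  have h1 := HL x0 x Ux0 Ux.
  have : `|x0 - x| <= e by rewrite distrC.
  lra.
pose Tf : {fun U >-> U} := HB.pack T (isFun.Build _ _ U U T TU).
have cU : closed U.
  have nc : continuous (fun x : 'rV[R]_n => `|x - x0|).
    move=> x; apply: (@continuous_comp _ _ _ (fun x => x - x0) (fun z : 'rV[R]_n => `|z|)).
      by apply: (@continuousB _ _ _ id (cst x0)); [exact: cvg_id|exact: cst_continuous].
    exact: norm_continuous.
  have -> : U = (fun x : 'rV[R]_n => `|x - x0|) @^-1` [set z | z <= e] by [].
  apply: closed_comp; last exact: closed_le.
  by move=> x _; exact: nc.
have [//| |x Ux fx] := @banach_fixed_point R 'rV[R]_n U Tf _ cU _.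
- exists (2^-1)%:nng; split=> /=; first by rewrite invf_lt1 ?ltr1n.
  move=> [x x'] [Ux Ux'] /=.
  rewrite /T opprB addrC subrKA; rewrite distrC.
  by rewrite [X in _ <= X * _](_ : _ = 2^-1)//; exact: HL.
- by exists x0.
by exists x => //; rewrite {1}fx /= /T subrK.
Qed.

Theorem inverse_function n (D : set 'rV[R]_n) (F : 'rV[R]_n -> 'rV[R]_n) p :
  open D -> D p -> smooth_on D F -> \det ('J F p) != 0 -> local_diffeo F p.
Proof.
move=> oD Dp FC det0.
set L := invmx ('J F p).
have Lu : 'J F p \in unitmx by rewrite unitmxE unitfE.
(* After multiplication by the inverse Jacobian at p, [F] becomes the identity plus [H], and [H] has
   zero differential at p. *)
pose H x := F x *m L - x.
have HC : smooth_on D H.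
  move=> k; apply: Ck_onB => //.
    apply: (Ck_on_comp_lin (L := mulmxr L) oD) (FC k).
    exact: linear_rV_continuous.
  by apply: (@Ck_on_lin _ _ _ _ _ idfun) => x; exact: cvg_id.
have [Fd Fk] := FC 1; have [Hd Hk] := HC 1.
have HE v x : D x -> 'D_v H x = 'D_v F x *m L - v.
  move=> Dx; have cL : continuous (mulmxr L : 'rV[R]_n -> 'rV[R]_n).
    exact: linear_rV_continuous.
  have [d1 d2] := is_derive_comp_lin v cL (Fd x Dx).
  rewrite deriveB; [|exact: diff_derivable|exact: derivable_id].
  by rewrite derive_id; congr (_ - _); exact: d2.
(* [ball_lipschitz] turns this into the Lipschitz constant n * e, at most 1/2; [n.+1] keeps [e]
   positive for n = 0 too. *)
pose e : R := (2 * n.+1%:R)^-1.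
have e0 : 0 < e by rewrite invr_gt0 mulr_gt0.
have : \forall x \near p, [/\ D x, \det ('J F x) != 0 &
    forall i j, `|('D_(delta_mx 0 i) H x) 0 j| <= e].
  have n1 : \forall x \near p, D x by exact: open_near Dp _.
  have n2 : \forall x \near p, \det ('J F x) != 0.
    have dC : Ck_on 0 D (fun x => \det ('J F x)).
      apply: (Ck_on_det oD) => i j.
      have FiC : Ck_on 0 D ('D_(delta_mx 0 i) F) by exact: Fk.
      apply: Ck_on_eq oD _ (Ck_on_coord j oD FiC) => x Dx /=.
      by rewrite jacobianE//; exact: Fd.
    have oN : open (~` [set 0 : R]) by exact/closed_openC/closed_eq.
    have nN : nbhs (\det ('J F p)) (~` [set 0 : R]).
      by apply: open_nbhs_nbhs; split => //; exact/eqP.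
    have : \forall x \near p, (~` [set 0 : R]) (\det ('J F x)) := dC p Dp _ nN.
    by apply: filterS => x /eqP.
  have n3 : \forall x \near p, forall i j, `|('D_(delta_mx 0 i) H x) 0 j| <= e.
    suff n4 : \forall x \near p, forall ij : 'I_n * 'I_n,
        `|('D_(delta_mx 0 ij.1) H x) 0 ij.2| <= e.
      by apply: filterS n4 => x Hx i j; exact: (Hx (i, j)).
    apply: (@filter_forall _ _ (fun (ij : 'I_n * 'I_n) (x : 'rV[R]_n) =>
      `|('D_(delta_mx 0 ij.1) H x) 0 ij.2| <= e) (nbhs p) _) => -[i j] /=.
    have cij : {for p, continuous (fun x => ('D_(delta_mx 0 i) H x) 0 j)}.
      have HiC : Ck_on 0 D ('D_(delta_mx 0 i) H) by exact: Hk.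
      exact: (Ck_on_coord j oD HiC).
    move/cvgrPdist_le : cij => /(_ e e0); apply: filterS => x.
    rewrite HE// deriveEjacobian; last exact: Fd.
    by rewrite mulmxK// subrr mxE sub0r normrN.
  by near=> x; split; near: x.
move=> /nbhs_ballP[r /= r0 Br].
pose A := ball p r.
have Hlip (x y : 'rV[R]_n) : A x -> A y -> `|H x - H y| <= 2^-1 * `|x - y|.
  move=> Ax Ay.
  have := @ball_lipschitz R n n H p r e _ _ (ltW e0) x y Ax Ay.
  move=> /(_ (fun z Bz => Hd z (let: And3 h _ _ := Br z Bz in h))).
  move=> /(_ (fun z i j Bz => (let: And3 _ _ h := Br z Bz in h i j))) h.
  apply: le_trans h _; rewrite ler_wpM2r// /e invfM mulrCA ler_piMr//.
  by rewrite ler_pdivrMr// mul1r ler_nat.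
have GE x : F x *m L = x + H x by rewrite /H addrC subrK.
have [C C0 HCb] := mulmx_norm_le L.
(* As [H] is 1/2-Lipschitz, |x - y| is at most twice |x + H x - (y + H y)|, and [C] bounds
   multiplication by [L]. This gives both injectivity and the hypothesis [FK]. *)
have Flip (x y : 'rV[R]_n) : A x -> A y -> `|x - y| <= (2 * C) * `|F x - F y|.
  move=> Ax Ay.
  have h1 := HCb (F x - F y); rewrite mulmxBl !GE in h1.
  have h2 := Hlip x y Ax Ay.
  have h3 : `|x - y| <= `|x + H x - (y + H y)| + `|H x - H y|.
    have -> : x - y = (x + H x - (y + H y)) - (H x - H y).
      by apply/rowP => i; rewrite !mxE; ring.
    exact: ler_normB.
  by rewrite -mulrA; lra.
have Finj (x y : 'rV[R]_n) : A x -> A y -> F x = F y -> x = y.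
  move=> Ax Ay Fxy; have := Flip x y Ax Ay.
  by rewrite Fxy subrr normr0 mulr0 normr_le0 subr_eq0 => /eqP.
have oA : open A by exact: ball_open.
have oFA : open (F @` A).
  (* A closed ball of radius s about x0 lies in [A], and [perturbation_surj] solves F x = y on it
     for all y close to F x0. *)
  rewrite openE => _ [x0 Ax0 <-].
  have /nbhs_ballP[d /= d0 Bd] : nbhs x0 A by exact: open_nbhs_nbhs.
  pose s := d / 2; have s0 : 0 < s by rewrite divr_gt0.
  have sA (x : 'rV[R]_n) : `|x - x0| <= s -> A x.
    move=> xs; apply: Bd; rewrite -ball_normE /= distrC.
    by apply: le_lt_trans xs _; rewrite /s ltr_pdivrMr// ltr_pMr// ltr1n.
  have : \forall y \near F x0, `|F x0 - y| < 2^-1 * s / C.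
    have q0 : 0 < 2^-1 * s / C by rewrite !mulr_gt0// ?invr_gt0.
    exact: (@cvgr_dist_lt _ _ _ (nbhs (F x0)) _ id (F x0) cvg_id _ q0).
  apply: filterS => y yF.
  have Hs x x' : `|x - x0| <= s -> `|x' - x0| <= s -> `|H x - H x'| <= 2^-1 * `|x - x'|.
    by move=> xs xs'; apply: Hlip; exact: sA.
  have ys : `|y *m L - (x0 + H x0)| <= 2^-1 * s.
    rewrite -GE -mulmxBl ; apply: le_trans (HCb _) _.
    by rewrite mulrC -ler_pdivlMr// distrC ltW.
  have [x xs xH] := perturbation_surj s0 Hs ys.
  exists x; first exact: sA.
  by move: xH; rewrite -GE => /(can_inj (mulmxK _)); apply; rewrite unitmx_inv.
(* The unique preimage in [A]; [p] is the default value off the image. *)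
pose psi y := xget p (A `&` [set x | F x = y]).
have psiK x : A x -> psi (F x) = x.
  move=> Ax; rewrite /psi; case: xgetP => [z _ [Az Fz]|/(_ x)]; first exact: Finj.
  by case; split.
have FCA : smooth_on A F by move=> k; apply: Ck_on_sub (FC k) => x /Br[].
have detA x : A x -> \det ('J F x) != 0 by move=> /Br[].
have C20 : 0 < 2 * C by rewrite mulr_gt0.
exists A, psi; split => //; first by split => //; exact: ballxx.
exact: (@inverse_smooth n A F psi (2 * C) oA oFA FCA psiK detA C20 Flip).
Unshelve. all: by end_near. Qed.

End InverseFunctionTheorem.

(** * Entire power series *)

Section EntireSeries.
Variable R : realType.
Implicit Types (c : nat -> R) (x s : R).

Definition psum c x : R := limn (pseries c x).

(* A class of coefficients stable under differentiation and shift, for which the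
   power series is dominated by the exponential series. *)
Definition inv_fact_bounded c := forall n, `|c n| <= n`!%:R^-1.

Lemma inv_fact_bounded_diffs c : inv_fact_bounded c -> inv_fact_bounded (pseries_diffs c).
Proof.
move=> cb n; rewrite /pseries_diffs normrM normr_nat.
by rewrite mulrC -ler_pdivlMr// -invfM mulrC -natrM -factS.
Qed.

Lemma inv_fact_bounded_shift c : inv_fact_bounded c -> inv_fact_bounded (c \o S).
Proof.
move=> cb n; apply: le_trans (cb n.+1) _.
by rewrite lef_pV2 ?posrE ?ltr0n ?fact_gt0// ler_nat factS leq_pmull.
Qed.

Lemma is_cvg_psum c x : inv_fact_bounded c -> cvgn (pseries c x).
Proof.
move=> cb; apply: normed_cvg.
apply: series_le_cvg; last exact: (is_cvg_series_exp_coeff `|x|).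
- by move=> n; rewrite normr_ge0.
- by move=> n; rewrite divr_ge0.
- move=> n /=; rewrite /exp_coeff /= normrM normrX mulrC.
  by rewrite ler_wpM2l// exprn_ge0.
Qed.

Lemma is_derive_psum c x : inv_fact_bounded c ->
  is_derive x 1 (psum c) (psum (pseries_diffs c) x).
Proof.
(* Term-by-term differentiation needs a point beyond |x| at which the series and its first two
   formal derivatives converge. *)
move=> cb; apply: (@pseries_snd_diffs _ c (`|x| + 1)).
- exact: is_cvg_psum.
- exact/is_cvg_psum/inv_fact_bounded_diffs.
- exact/is_cvg_psum/inv_fact_bounded_diffs/inv_fact_bounded_diffs.
- by rewrite [ltRHS]ger0_norm// ltrDl.
Qed.

Lemma Ck_on_psum c k (D : set R) : inv_fact_bounded c -> Ck_on k D (psum c).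
Proof.
move=> cb; suff : Ck_on k setT (psum c) by apply: Ck_on_sub.
elim: k c cb => [|k IH] c cb.
  move=> x _; apply/differentiable_continuous/derivable1_diffP.
  by have [] := is_derive_psum x cb.
split=> [x _|v]; first by apply/derivable1_diffP; have [] := is_derive_psum x cb.
apply: Ck_on_eq openT _ (Ck_onM openT (Ck_on_cst k _ v) (IH _ (inv_fact_bounded_diffs cb))).
move=> x _; have [d1 d2] := is_derive_psum x cb.
have fx : differentiable (psum c) x by apply/derivable1_diffP.
by rewrite [RHS]deriveE// diff1E// derive1E d2.
Qed.

Lemma psum_shift c x : inv_fact_bounded c -> psum c x = c 0%N + x * psum (c \o S) x.
Proof.
move=> cb; apply/cvg_lim => //.
have : (fun n => c 0%N + x * pseries (c \o S) x n) @ \oo --> c 0%N + x * psum (c \o S) x.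
  apply: cvgD; first exact: cvg_cst.
  apply: cvgM; first exact: cvg_cst.
  exact/is_cvg_psum/inv_fact_bounded_shift.
rewrite -[X in _ -> X](@cvg_shiftS _ (pseries c x)).
rewrite (_ : (fun n => c 0%N + _) = [sequence pseries c x n.+1]_n)//.
apply/funext => n; rewrite /pseries /series /= big_nat_recl//= expr0 mulr1; congr (_ + _).
by rewrite mulr_sumr; apply: eq_bigr => i _; rewrite exprS mulrCA.
Qed.

(** Splitting off two coefficients is an exact Taylor formula whose quotient is again an entire
    series. For [cosq] and [sinq] at s = x^2 it leaves factors x^4, so the later remainders are
    identities rather than estimates. *)
Lemma psum_expand2 c : inv_fact_bounded c ->
  exists2 g : R -> R, continuous g & forall s, psum c s = c 0%N + c 1%N * s + s ^+ 2 * g s.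
Proof.
move=> cb; have cb1 := inv_fact_bounded_shift cb; have cb2 := inv_fact_bounded_shift cb1.
exists (psum ((c \o S) \o S)) => [x|s].
  exact: (@Ck_on_psum _ 0 setT cb2).
by rewrite psum_shift// psum_shift//=; ring.
Qed.

(* cos (sqrt s) and sin (sqrt s) / sqrt s, also for s <= 0. *)
Definition cosq : R -> R := psum (fun n => (-1) ^+ n / n.*2`!%:R).
Definition sinq : R -> R := psum (fun n => (-1) ^+ n / n.*2.+1`!%:R).

Lemma ler_inv_fact m n : (n <= m)%N -> `|(-1) ^+ n / m`!%:R| <= n`!%:R^-1 :> R.
Proof.
move=> nm; rewrite normrM normrX normrN1 expr1n mul1r ger0_norm//.
rewrite lef_pV2 ?posrE ?ltr0n ?fact_gt0// ler_nat (fact_split nm) leq_pmulr//.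
by rewrite big_seq_cond prodn_cond_gt0// => i; rewrite mem_index_iota => /andP[/andP[]]; case: i.
Qed.

Lemma cosq_bounded : inv_fact_bounded (fun n => (-1) ^+ n / n.*2`!%:R).
Proof. by move=> n; apply: ler_inv_fact; rewrite -addnn leq_addr. Qed.

Lemma sinq_bounded : inv_fact_bounded (fun n => (-1) ^+ n / n.*2.+1`!%:R).
Proof. by move=> n; apply: ler_inv_fact; rewrite -addnn leqW// leq_addr. Qed.

Lemma Ck_on_cosq k (D : set R) : Ck_on k D cosq.
Proof. exact: (Ck_on_psum _ _ cosq_bounded). Qed.

Lemma Ck_on_sinq k (D : set R) : Ck_on k D sinq.
Proof. exact: (Ck_on_psum _ _ sinq_bounded). Qed.

Lemma cos_cosq x : cos x = cosq (x ^+ 2).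
Proof.
apply/esym/cvg_lim => //.
rewrite (_ : pseries _ _ = series (cos_coeff' x)); first exact: cvg_cos_coeff'.
congr series; apply/funext => n; rewrite /cos_coeff' /= -exprM mul2n.
by rewrite mulrAC.
Qed.

Lemma sin_sinq x : sin x = x * sinq (x ^+ 2).
Proof.
apply/esym; have H := @is_cvg_psum _ (x ^+ 2) sinq_bounded.
have : (fun n => x * pseries (fun n => (-1) ^+ n / n.*2.+1`!%:R) (x ^+ 2) n) @ \oo --> x * sinq (x ^+ 2).
  by apply: cvgM; [exact: cvg_cst|exact: H].
move=> /cvg_lim <-//; apply/cvg_lim => //.
rewrite (_ : (fun n => _) = series (sin_coeff' x)); first exact: cvg_sin_coeff'.
apply/funext => n; rewrite /series /= mulr_sumr; apply: eq_bigr => i _.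
rewrite /sin_coeff' /= -exprM mul2n exprS -!exprnP. ring.
Qed.

Lemma cosq_expand : exists2 g : R -> R, continuous g &
  forall s, cosq s = 1 - s / 2 + s ^+ 2 * g s.
Proof.
have [g gc gE] := psum_expand2 cosq_bounded; exists g => // s.
by rewrite /cosq gE !doubleS double0 !factS fact0 expr0 expr1; field.
Qed.

Lemma sinq_expand : exists2 g : R -> R, continuous g &
  forall s, sinq s = 1 - s / 6 + s ^+ 2 * g s.
Proof.
have [g gc gE] := psum_expand2 sinq_bounded; exists g => // s.
by rewrite /sinq gE !doubleS double0 !factS fact0 expr0 expr1; field.
Qed.
End EntireSeries.

(** * Uniqueness of the normal form *)

Section Rays.
Variable R : realType.
Implicit Types (c : coefs R).

(** [jet2] and [jet3] are the homogeneous parts of degrees 2 and 3 of the third component, so along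
    a ray they scale with r^2 and r^3. *)
Definition jet2 c (u v : R) : R :=
  coef_a c 0 2 / 2 * v ^+ 2 + coef_a c 1 1 * u * v + coef_a c 2 0 / 2 * u ^+ 2.
Definition jet3 c (u v : R) : R :=
  coef_a c 0 3 / 6 * v ^+ 3 + coef_a c 1 2 / 2 * u * v ^+ 2
  + coef_a c 2 1 / 2 * u ^+ 2 * v + coef_a c 3 0 / 6 * u ^+ 3.
Definition jety c (u v : R) : R := u * v + coef_b c 3 / 6 * v ^+ 3.
Definition jetz c (u v : R) : R := jet2 c u v + jet3 c u v.

Lemma cvg_mul_bounded (g : R -> R) (K : R) :
  (\forall r \near 0^', `|g r| <= K) -> r * g r @[r --> 0^'] --> (0 : R).
Proof.
move=> H; apply/cvgr0Pnorm_le => e e0.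
have K1 : 0 < `|K| + 1 by rewrite ltr_wpDl.
have e1 : 0 < e / (`|K| + 1) by rewrite divr_gt0.
have := @dnbhs0_lt R R _ e1.
apply: filterS2 H => r gK rlt; rewrite normrM.
rewrite ltr_pdivlMr// in rlt.
have : `|r| * `|g r| <= `|r| * (`|K| + 1).
  by rewrite ler_wpM2l// (le_trans gK)// (le_trans (ler_norm K))// lerDl.
by move=> h; rewrite (le_trans h)// ltW.
Qed.

(** The principle behind all order comparisons: a discrepancy divided by a power of r tends to its
    leading coefficient [l], and what is left on the other side is r times something bounded. *)
Lemma lim_bounded_mul (f g : R -> R) (l K : R) :
  f r @[r --> 0^'] --> l ->
  (\forall r \near 0^', f r = r * g r /\ `|g r| <= K) -> l = 0.
Proof.
move=> fl H; have g0 : r * g r @[r --> 0^'] --> (0 : R).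
  by apply: (@cvg_mul_bounded g K); apply: filterS H => r [].
apply: (@cvg_unique _ (@norm_hausdorff _ R) _ _ _ _ fl).
apply: cvg_trans g0; apply: near_eq_cvg; apply: filterS H => r [-> _] //.
Qed.

Lemma cvgX_dnbhs (g : R -> R) (l : R) n :
  g r @[r --> 0^'] --> l -> g r ^+ n @[r --> 0^'] --> l ^+ n.
Proof. by move=> gl; exact: (cvg_comp _ _ gl (@exprn_continuous R n l)). Qed.

Lemma id_dnbhs : r @[r --> 0^'] --> (0 : R).
Proof. exact: cvg_within. Qed.

Lemma bounded_mul_dnbhs (E : R -> R) (K : R) n : (\forall r \near 0^', `|E r| <= K) ->
  \forall r \near 0^', `|r ^+ n * E r| <= K.
Proof.
move=> EK; have l1 := @dnbhs0_lt R R _ (@ltr01 R).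
apply: filterS2 EK l1 => r Er /ltW r1.
by rewrite normrM -[leRHS]mul1r ler_pM// normrX exprn_ile1.
Qed.

(* Along the ray r -> r (al, eta) the coordinate change is r -> r (P r, Q r), and
   r^4 E r is the discrepancy of one coordinate of the two jets; a0, a1, a2 is the
   corresponding column of the rotation, and t1, t2, t3 are the coefficients of
   the second jet. *)
Section Ray.
Variables (c : coefs R) (a0 a1 a2 t1 t2 t3 K p1 q1 : R) (P Q E : R -> R).
Hypotheses (Pl : P r @[r --> 0^'] --> p1) (Ql : Q r @[r --> 0^'] --> q1).
Hypothesis EK : \forall r \near 0^', `|E r| <= K.
Hypothesis eqE : \forall r \near 0^',
  a0 * (r * P r) + a1 * jety c (r * P r) (r * Q r) + a2 * jetz c (r * P r) (r * Q r)
  - (t1 * r + t2 * r ^+ 2 + t3 * r ^+ 3) = r ^+ 4 * E r.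

Let B := coef_b c 3 / 6.

Let nz : \forall r \near 0^', r != 0 :> R.
Proof. exact: nbhs_dnbhs_neq. Qed.

Ltac solve_cvg := repeat lazymatch goal with
  | |- cvg_to _ (nbhs (_ + _)) => apply: cvgD
  | |- cvg_to _ (nbhs (- _)) => apply: cvgN
  | |- cvg_to _ (nbhs (_ ^+ _)) => apply: cvgX_dnbhs
  | |- cvg_to _ (nbhs (_ * _)) => apply: cvgM
  | |- cvg_to _ (nbhs p1) => exact: Pl
  | |- cvg_to _ (nbhs q1) => exact: Ql
  | |- cvg_to _ (nbhs 0) => exact: id_dnbhs
  | |- _ => exact: cvg_cst
  end.

Lemma ray_order1 : a0 * p1 = t1.
Proof.
pose f r := a0 * P r + r * (a1 * (P r * Q r + r * (B * Q r ^+ 3))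
  + a2 * (jet2 c (P r) (Q r) + r * jet3 c (P r) (Q r))) - t1 - t2 * r - t3 * r ^+ 2.
(* [l] is [f] with 0, p1, q1 in place of r, P r, Q r, left unsimplified so that the limit rules can
   follow its shape. *)
pose l := a0 * p1 + 0 * (a1 * (p1 * q1 + 0 * (B * q1 ^+ 3))
  + a2 * (jet2 c p1 q1 + 0 * jet3 c p1 q1)) - t1 - t2 * 0 - t3 * 0 ^+ 2.
have fl : f r @[r --> 0^'] --> l.
  by rewrite /f /l /jet2 /jet3; solve_cvg.
have : l = 0.
  apply: (@lim_bounded_mul f (fun r => r ^+ 2 * E r) l K fl).
  apply: filterS3 eqE (bounded_mul_dnbhs 2 EK) nz => r er Er r0; split => //.
  apply: (mulfI r0); rewrite [RHS](_ : _ = r ^+ 4 * E r); last by ring.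
  by rewrite -er /f /jety /jetz /jet2 /jet3 /B; field.
by rewrite /l => h; lra.
Qed.

Lemma ray_order2 : a0 = 0 -> t1 = 0 -> a1 * (p1 * q1) + a2 * jet2 c p1 q1 = t2.
Proof.
move=> a00 t10.
pose f r := a1 * (P r * Q r + r * (B * Q r ^+ 3))
  + a2 * (jet2 c (P r) (Q r) + r * jet3 c (P r) (Q r)) - t2 - t3 * r.
pose l := a1 * (p1 * q1 + 0 * (B * q1 ^+ 3))
  + a2 * (jet2 c p1 q1 + 0 * jet3 c p1 q1) - t2 - t3 * 0.
have fl : f r @[r --> 0^'] --> l.
  by rewrite /f /l /jet2 /jet3; solve_cvg.
have : l = 0.
  apply: (@lim_bounded_mul f (fun r => r * E r) l K fl).
  apply: filterS3 eqE (bounded_mul_dnbhs 1 EK) nz => r er Er r0; split => //.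
  apply: (mulfI r0); apply: (mulfI r0).
  rewrite [RHS](_ : _ = r ^+ 4 * E r); last by rewrite /=; ring.
  by rewrite -er /f /jety /jetz /jet2 /jet3 /B a00 t10; field.
by rewrite /l => h; lra.
Qed.

End Ray.

Section RayOrder3.
Variables (c c' : coefs R) (al eta K : R) (P Q E0 E1 E2 : R -> R).
Hypotheses (Pl : P r @[r --> 0^'] --> al) (Ql : Q r @[r --> 0^'] --> eta).
Hypotheses (E0K : \forall r \near 0^', `|E0 r| <= K)
  (E1K : \forall r \near 0^', `|E1 r| <= K) (E2K : \forall r \near 0^', `|E2 r| <= K).
Hypothesis eq0 : \forall r \near 0^', r * P r - r * al = r ^+ 4 * E0 r.
Hypothesis eq1 : \forall r \near 0^',
  jety c (r * P r) (r * Q r) - jety c' (r * al) (r * eta) = r ^+ 4 * E1 r.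
Hypothesis eq2 : \forall r \near 0^',
  jetz c (r * P r) (r * Q r) - jetz c' (r * al) (r * eta) = r ^+ 4 * E2 r.

Let B := coef_b c 3 / 6.
Let B' := coef_b c' 3 / 6.

Let nz : \forall r \near 0^', r != 0 :> R.
Proof. exact: nbhs_dnbhs_neq. Qed.

(** [a] and [b] measure the second-order part of the coordinate change along the ray.
    Differentiability at 0 does not make them converge; their limits are extracted from [eq0] and
    [eq1]. *)
Let a r := (P r - al) / r.
Let b r := (Q r - eta) / r.

Let a0 : a r @[r --> 0^'] --> (0 : R).
Proof.
apply: cvg_trans (cvg_mul_bounded (bounded_mul_dnbhs 1 E0K)).
apply: near_eq_cvg; apply: filterS2 eq0 nz => r er r0.
apply: (mulfI r0); apply: (mulfI r0); rewrite [LHS](_ : _ = r ^+ 4 * E0 r); last by ring.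
by rewrite -er /a; field.
Qed.

Let rE1 : r * E1 r @[r --> 0^'] --> (0 : R).
Proof. exact: cvg_mul_bounded E1K. Qed.

Ltac solve_cvg := repeat lazymatch goal with
  | |- cvg_to _ (nbhs (_ + _)) => apply: cvgD
  | |- cvg_to _ (nbhs (- _)) => apply: cvgN
  | |- cvg_to _ (nbhs (_ ^+ _)) => apply: cvgX_dnbhs
  | |- cvg_to (nbhs (fmap (fun r => r * E1 r) _)) _ => exact: rE1
  | |- cvg_to _ (nbhs (_ * _)) => apply: cvgM
  | |- cvg_to _ (nbhs al) => first [exact: Pl | exact: cvg_cst]
  | |- cvg_to _ (nbhs eta) => first [exact: Ql | exact: cvg_cst]
  | |- _ => first [exact: a0 | exact: rE1 | exact: cvg_cst]
  end.

(** On this ray P r = r * a r, so the product u v is r^3 * a r * Q r, of order higher than 3, and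
    only the cubic terms in v survive. *)
Lemma ray_order3_b : al = 0 -> B * eta ^+ 3 = B' * eta ^+ 3.
Proof.
move=> al0.
pose f r := a r * Q r + B * Q r ^+ 3 - B' * eta ^+ 3.
pose l := 0 * eta + B * eta ^+ 3 - B' * eta ^+ 3.
have fl : f r @[r --> 0^'] --> l.
  by rewrite /f /l; solve_cvg.
have : l = 0.
  apply: (@lim_bounded_mul f E1 l K fl).
  apply: filterS3 eq1 E1K nz => r er Er r0; split => //.
  apply: (mulfI r0); apply: (mulfI r0); apply: (mulfI r0).
  rewrite [RHS](_ : _ = r ^+ 4 * E1 r); last by ring.
  by rewrite -er /f /jety /a al0 -/B -/B'; field.
by rewrite /l mul0r add0r => /eqP; rewrite subr_eq0 => /eqP.
Qed.

(** Equality of the cubic terms of the second component forces [b] to tend to 0. The change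
    therefore alters the quadratic part of the third component only beyond order 3, which leaves the
    cubic parts to be compared. *)
Lemma ray_order3_z : al = 1 -> B = B' -> jet2 c 1 eta = jet2 c' 1 eta ->
  jet3 c 1 eta = jet3 c' 1 eta.
Proof.
move=> al1 BB J2.
have b0 : b r @[r --> 0^'] --> (0 : R).
  pose f r := r * E1 r - (B * Q r ^+ 3 - B' * eta ^+ 3) - a r * Q r.
  have fl : f r @[r --> 0^'] --> 0 - (B * eta ^+ 3 - B' * eta ^+ 3) - 0 * eta.
    by rewrite /f; solve_cvg.
  rewrite BB subrr subrr mul0r subrr in fl.
  apply: cvg_trans fl; apply: near_eq_cvg; apply: filterS2 eq1 nz => r er r0.
  apply: (mulfI r0); apply: (mulfI r0).
  rewrite /f [LHS](_ : _ = r ^+ 4 * E1 r / r - r * (r * ((B * Q r ^+ 3 - B' * eta ^+ 3) + a r * Q r))); last by field.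
  by rewrite -er /jety /a /b al1 -/B -/B'; field.
pose h r := coef_a c 0 2 / 2 * (b r * (Q r + eta)) + coef_a c 1 1 * (a r * Q r + b r)
  + coef_a c 2 0 / 2 * (a r * (P r + 1)).
have hl : h r @[r --> 0^'] --> coef_a c 0 2 / 2 * (0 * (eta + eta))
   + coef_a c 1 1 * (0 * eta + 0) + coef_a c 2 0 / 2 * (0 * (al + 1)).
  rewrite /h; apply: cvgD; [apply: cvgD|].
  - by apply: cvgM; [exact: cvg_cst|apply: cvgM => //; solve_cvg].
  - by apply: cvgM; [exact: cvg_cst|apply: cvgD => //; solve_cvg].
  - by solve_cvg.
rewrite !(mul0r, addr0, mulr0) in hl.
pose f r := h r + (jet3 c (P r) (Q r) - jet3 c' al eta).
pose l := 0 + (jet3 c al eta - jet3 c' al eta).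
have fl : f r @[r --> 0^'] --> l.
  by rewrite /f /l; apply: cvgD => //; rewrite /jet3; solve_cvg.
have : l = 0.
  apply: (@lim_bounded_mul f E2 l K fl).
  apply: filterS3 eq2 E2K nz => r er Er r0; split => //.
  apply: (mulfI r0); apply: (mulfI r0); apply: (mulfI r0).
  rewrite [RHS](_ : _ = r ^+ 4 * E2 r); last by ring.
  have -> : r * (r * (r * f r)) = r ^+ 2 * (jet2 c (P r) (Q r) - jet2 c 1 eta
     + r * (jet3 c (P r) (Q r) - jet3 c' al eta)).
    by rewrite /f /h /a /b /jet2 al1; field.
  by rewrite -er J2 /jetz /jet2 /jet3 al1; ring.
by rewrite /l add0r al1 => /eqP; rewrite subr_eq0 => /eqP.
Qed.

End RayOrder3.
End Rays.

Section SmallMatrices.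
Variable R : comNzRingType.

Lemma sum_ord2 (F : 'I_2 -> R) : \sum_i F i = F 0 + F 1.
Proof. by rewrite !big_ord_recl big_ord0 addr0; congr (_ + F _); exact: val_inj. Qed.

Lemma sum_ord3 (F : 'I_3 -> R) : \sum_i F i = F 0 + F 1 + F 2%:R.
Proof.
rewrite !big_ord_recl big_ord0 addr0 addrA.
by congr (_ + F _ + F _); exact: val_inj.
Qed.

Lemma forall_ord3 (P : 'I_3 -> Prop) : P 0 -> P 1 -> P 2%:R -> forall j, P j.
Proof.
move=> P0 P1 P2 [[|[|[|//]]] H].
- by rewrite (_ : Ordinal H = 0)//; exact: val_inj.
- by rewrite (_ : Ordinal H = 1)//; exact: val_inj.
- by rewrite (_ : Ordinal H = 2%:R)//; exact: val_inj.
Qed.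

Lemma forall_ord2 (P : 'I_2 -> Prop) : P 0 -> P 1 -> forall j, P j.
Proof.
move=> P0 P1 [[|[|//]] H].
- by rewrite (_ : Ordinal H = 0)//; exact: val_inj.
- by rewrite (_ : Ordinal H = 1)//; exact: val_inj.
Qed.

Lemma det_mx2 (M : 'M[R]_2) : \det M = M 0 0 * M 1 1 - M 0 1 * M 1 0.
Proof.
rewrite (expand_det_row _ 0) sum_ord2 /cofactor !det_mx11 !mxE /=.
rewrite (_ : lift 0 0 = 1); last exact: val_inj.
rewrite (_ : lift 1 0 = 0); last exact: val_inj.
by rewrite /= addn0 add0n expr0 expr1; ring.
Qed.

Lemma det_mx3 (M : 'M[R]_3) : \det M =
  M 0 0 * (M 1 1 * M 2%:R 2%:R - M 1 2%:R * M 2%:R 1)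
  - M 0 1 * (M 1 0 * M 2%:R 2%:R - M 1 2%:R * M 2%:R 0)
  + M 0 2%:R * (M 1 0 * M 2%:R 1 - M 1 1 * M 2%:R 0).
Proof.
rewrite (expand_det_row _ 0) sum_ord3 /cofactor !det_mx2 !mxE /=.
rewrite (_ : lift 0 0 = 1 :> 'I_3); last exact: val_inj.
rewrite (_ : lift 0 1 = 2%:R :> 'I_3); last exact: val_inj.
rewrite (_ : lift 1 0 = 0 :> 'I_3); last exact: val_inj.
rewrite (_ : lift 1 1 = 2%:R :> 'I_3); last exact: val_inj.
rewrite (_ : lift 2%:R 0 = 0 :> 'I_3); last exact: val_inj.
rewrite (_ : lift 2%:R 1 = 1 :> 'I_3); last exact: val_inj.
by rewrite /= !add0n expr0 expr1 sqrrN expr1n; ring.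
Qed.
End SmallMatrices.

(** * Rigidity of cubic jets under a rotation and a coordinate change *)

Section Rigid.
Variable R : realType.
Implicit Types (c : coefs R).

Lemma row3E (x y z : R) : (row3 x y z 0 0 = x) * (row3 x y z 0 1 = y) * (row3 x y z 0 2%:R = z).
Proof. by rewrite !mxE. Qed.

(** Normal forms of every order n >= 3 are truncated to this one, which makes forms of different
    orders comparable. *)
Definition cubic_jet c (x : 'rV[R]_2) : 'rV[R]_3 :=
  row3 (x 0 0) (jety c (x 0 0) (x 0 1)) (jetz c (x 0 0) (x 0 1)).

Lemma cubic_jet0 c : cubic_jet c 0 = 0.
Proof.
apply/rowP; apply: forall_ord3; rewrite /cubic_jet !row3E ?mxE//.
  by rewrite /jety; ring.
by rewrite /jetz /jet2 /jet3; ring.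
Qed.

Section Rigidity.
Variables (c c' : coefs R) (B : 'M[R]_3) (w : 'rV[R]_3) (psi : 'rV[R]_2 -> 'rV[R]_2) (K : R).
Hypotheses (BO : B *m B^T = 1%:M) (Bdet : \det B = 1).
Hypotheses (a02 : 0 < coef_a c 0 2) (a02' : 0 < coef_a c' 0 2).
Hypotheses (dpsi : differentiable psi 0) (psi0 : psi 0 = 0) (detpsi : 0 < \det ('J psi 0)).
Hypothesis jetE : \forall x \near (0 : 'rV[R]_2),
  `|cubic_jet c (psi x) *m B + w - cubic_jet c' x| <= K * `|x| ^+ 4.

Let w0 : w = 0.
Proof.
have := nbhs_singleton jetE.
rewrite psi0 !cubic_jet0 mul0mx add0r subr0 normr0 expr0n mulr0.
by rewrite normr_le0 => /eqP.
Qed.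

Let J := 'J psi 0.

(** [P] and [Q] are the coordinates of psi (r x0) / r, which converge to those of x0 *m J; [E] is
    the discrepancy divided by r^4, bounded by K |x0|^4. *)
Lemma ray_data (al eta : R) : exists (P Q : R -> R) (E : 'I_3 -> R -> R) (K' : R),
  [/\ P r @[r --> 0^'] --> al * J 0 0 + eta * J 1 0,
      Q r @[r --> 0^'] --> al * J 0 1 + eta * J 1 1,
      forall j, \forall r \near 0^', `|E j r| <= K'
    & forall j, \forall r \near 0^',
      B 0 j * (r * P r) + B 1 j * jety c (r * P r) (r * Q r)
      + B 2%:R j * jetz c (r * P r) (r * Q r)
      - (row3 (r * al) (jety c' (r * al) (r * eta)) (jetz c' (r * al) (r * eta))) 0 j
      = r ^+ 4 * E j r].
Proof.
pose x0 : 'rV[R]_2 := \row_j [:: al; eta]`_j.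
have x00 : x0 0 0 = al by rewrite mxE.
have x01 : x0 0 1 = eta by rewrite mxE.
pose P j (r : R) := r^-1 * psi (r *: x0) 0 j.
have PE j r : r != 0 -> r * P j r = psi (r *: x0) 0 j by move=> r0; rewrite /P mulVKf.
have Pl j : P j r @[r --> 0^'] --> al * J 0 j + eta * J 1 j.
  have : derivable psi 0 x0 by exact: diff_derivable.
  move=> /cvg_ex[l Hl].
  have lE : l = 'D_x0 psi 0 by apply/esym/cvg_lim.
  rewrite deriveEjacobian// in lE.
  have -> : al * J 0 j + eta * J 1 j = l 0 j.
    by rewrite lE [RHS]mxE sum_ord2 x00 x01.
  have := cvg_comp _ _ Hl (@coord_continuous R 1 2 0 j l).
  rewrite (_ : _ \o _ = P j)//; apply/funext => r /=.
  by rewrite psi0 subr0 addr0 !mxE.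
pose D j r := (cubic_jet c (psi (r *: x0)) *m B - cubic_jet c' (r *: x0)) 0 j.
exists (P 0), (P 1), (fun j r => D j r / r ^+ 4), (K * `|x0| ^+ 4); split => //.
- move=> j.
  have nr : \forall r \near 0^', r != 0 :> R by exact: nbhs_dnbhs_neq.
  have sc : (r *: x0) @[r --> (0 : R)] --> (0 : 'rV[R]_2).
    rewrite -[X in _ --> X](scale0r x0).
    exact: (@scalel_continuous R _ x0 0).
  have nj : \forall r \near 0^', `|cubic_jet c (psi (r *: x0)) *m B + w -
      cubic_jet c' (r *: x0)| <= K * `|r *: x0| ^+ 4.
    exact: (nbhs_dnbhs (sc _ jetE)).
  apply: filterS2 nj nr => r H r0.
  have r40 : 0 < `|r ^+ 4| by rewrite normr_gt0 expf_neq0.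
  rewrite normrM normfV ler_pdivrMr//.
  apply: le_trans (rV_norm_coord _ _) _.
  rewrite w0 addr0 in H; apply: le_trans H _.
  by rewrite normrZ exprMn normrX mulrA mulrAC.
- move=> j; have nr : \forall r \near 0^', r != 0 :> R by exact: nbhs_dnbhs_neq.
  apply: filterS nr => r r0.
  rewrite [RHS](_ : _ = D j r); last by rewrite /= mulrCA mulfV ?mulr1// expf_neq0.
  rewrite /D [RHS]mxE [X in _ = X + _]mxE sum_ord3 [in RHS]/cubic_jet !row3E !PE//.
  rewrite [X in _ = _ + X]mxE /cubic_jet.
  have -> : (r *: x0) 0 0 = r * al by rewrite mxE x00.
  have -> : (r *: x0) 0 1 = r * eta by rewrite mxE x01.
  by congr (_ - _); ring.
Qed.

Let BO' : B^T *m B = 1%:M.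
Proof. exact: mulmx1C. Qed.

(** First-order comparison: only the first component of a cubic jet has a linear term, so only the
    first row of [B] enters. *)
Lemma ray_tangent (al eta : R) j :
  B 0 j * (al * J 0 0 + eta * J 1 0) = (row3 al 0 0) 0 j.
Proof.
have [P [Q [E [K' [Pl Ql EK eqE]]]]] := ray_data al eta.
move: j; apply: forall_ord3; rewrite row3E.
- apply: (ray_order1 (t2 := 0) (t3 := 0) Pl Ql (EK 0)).
  by apply: filterS (eqE 0) => r <-; rewrite row3E; congr (_ - _); ring.
- apply: (ray_order1 (t2 := al * eta) (t3 := coef_b c' 3 / 6 * eta ^+ 3) Pl Ql (EK 1)).
  apply: filterS (eqE 1) => r <-; rewrite row3E /jety; congr (_ - _); ring.
- apply: (ray_order1 (t2 := jet2 c' al eta) (t3 := jet3 c' al eta) Pl Ql (EK 2%:R)).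
  apply: filterS (eqE 2%:R) => r <-; rewrite row3E /jetz /jet2 /jet3; congr (_ - _); ring.
Qed.

Lemma ray_quadratic_y (al eta : R) : B 0 1 = 0 ->
  B 1 1 * ((al * J 0 0 + eta * J 1 0) * (al * J 0 1 + eta * J 1 1))
  + B 2%:R 1 * jet2 c (al * J 0 0 + eta * J 1 0) (al * J 0 1 + eta * J 1 1) = al * eta.
Proof.
move=> B01; have [P [Q [E [K' [Pl Ql EK eqE]]]]] := ray_data al eta.
apply: (ray_order2 (t3 := coef_b c' 3 / 6 * eta ^+ 3) Pl Ql (EK 1) _ B01 erefl).
by apply: filterS (eqE 1) => r <-; rewrite row3E /jety; congr (_ - _); ring.
Qed.

Lemma ray_quadratic_z (al eta : R) : B 0 2%:R = 0 ->
  B 1 2%:R * ((al * J 0 0 + eta * J 1 0) * (al * J 0 1 + eta * J 1 1))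
  + B 2%:R 2%:R * jet2 c (al * J 0 0 + eta * J 1 0) (al * J 0 1 + eta * J 1 1)
  = jet2 c' al eta.
Proof.
move=> B02; have [P [Q [E [K' [Pl Ql EK eqE]]]]] := ray_data al eta.
apply: (ray_order2 (t3 := jet3 c' al eta) Pl Ql (EK 2%:R) _ B02 erefl).
by apply: filterS (eqE 2%:R) => r <-; rewrite row3E /jetz /jet2 /jet3; congr (_ - _); ring.
Qed.

Let BOE i j : B i 0 * B j 0 + B i 1 * B j 1 + B i 2%:R * B j 2%:R = (i == j)%:R.
Proof.
have := congr1 (fun M : 'M[R]_3 => M i j) BO.
by rewrite /= [LHS]mxE sum_ord3 !mxE => <-.
Qed.

Let BOE' i j : B 0 i * B 0 j + B 1 i * B 1 j + B 2%:R i * B 2%:R j = (i == j)%:R.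
Proof.
have := congr1 (fun M : 'M[R]_3 => M i j) BO'.
by rewrite /= [LHS]mxE sum_ord3 !mxE => <-.
Qed.

Lemma sqr_add3_eq1 (x y z : R) : x ^+ 2 = 1 -> x * x + y * y + z * z = 1 -> y = 0 /\ z = 0.
Proof.
move=> x1 H; have yz : y ^+ 2 + z ^+ 2 = 0 by rewrite !expr2 in x1 *; lra.
have y2 := sqr_ge0 y; have z2 := sqr_ge0 z.
have y0 : y ^+ 2 == 0 by apply/eqP; lra.
have z0 : z ^+ 2 == 0 by apply/eqP; lra.
by move: y0 z0; rewrite !sqrf_eq0 => /eqP -> /eqP ->.
Qed.

(* The tangent line fixes the first row and column of B; the second-order part
   of the ray (0, 1) then makes B diagonal, and the remaining signs are fixed by
   orientation and by the positivity of a_{02}. *)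
Lemma rigid_linear_part : B = 1%:M /\ [/\ J 0 0 = 1, J 1 0 = 0, J 0 1 = 0 & J 1 1 = 1].
Proof.
have T10 := ray_tangent 1 0; have T01 := ray_tangent 0 1.
have := T10 0; rewrite row3E mul1r mul0r addr0 => b00.
have := T10 1; rewrite row3E mul1r mul0r addr0 => b01.
have := T10 2%:R; rewrite row3E mul1r mul0r addr0 => b02.
have := T01 0; rewrite row3E mul1r mul0r add0r => b00'.
have j00 : J 0 0 != 0.
  by apply/eqP => j0; move: b00; rewrite j0 mulr0 => /esym/eqP; rewrite oner_eq0.
have b000 : B 0 0 != 0.
  by apply/eqP => j0; move: b00; rewrite j0 mul0r => /esym/eqP; rewrite oner_eq0.
have {}b01 : B 0 1 = 0 by move/eqP: b01; rewrite mulf_eq0 (negbTE j00) orbF => /eqP.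
have {}b02 : B 0 2%:R = 0 by move/eqP: b02; rewrite mulf_eq0 (negbTE j00) orbF => /eqP.
have j10 : J 1 0 = 0 by move/eqP: b00'; rewrite mulf_eq0 (negbTE b000) => /eqP.
have b00s : B 0 0 ^+ 2 = 1 by have := BOE 0 0; rewrite b01 b02 !mul0r !addr0 eqxx.
have [b10 b20] := sqr_add3_eq1 b00s (BOE' 0 0).
have dJ : 0 < J 0 0 * J 1 1 by move: detpsi; rewrite det_mx2 j10 mulr0 subr0.
have j11 : J 1 1 != 0 by apply/eqP => j0; rewrite j0 mulr0 ltxx in dJ.
have b21 : B 2%:R 1 = 0.
  have := ray_quadratic_y 0 1 b01.
  rewrite !mul0r !mul1r !add0r j10 mul0r mulr0 add0r /jet2 !(mulr0, mul0r, addr0, expr0n).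
  move/eqP; rewrite mulf_eq0 => /orP[/eqP//|/eqP h].
  have : 0 < coef_a c 0 2 / 2 * J 1 1 ^+ 2.
    by rewrite mulr_gt0 ?divr_gt0// exprn_even_gt0.
  by rewrite h ltxx.
have b22s : B 2%:R 2%:R ^+ 2 = 1.
  by have := BOE 2%:R 2%:R; rewrite b20 b21 !mul0r !add0r eqxx.
have b12 : B 1 2%:R = 0.
  have := BOE' 2%:R 2%:R; rewrite b02 mul0r add0r eqxx -!expr2 b22s.
  by move/eqP; rewrite -subr_eq0 addrK sqrf_eq0 => /eqP.
have b22 : B 2%:R 2%:R = 1.
  have := ray_quadratic_z 0 1 b02.
  rewrite b12 mul0r add0r /jet2 !mul0r !mul1r !add0r j10 !(mulr0, mul0r, addr0, expr0n, expr1n, mulr1) /= => h.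
  move/eqP: b22s; rewrite sqrf_eq1 => /orP[/eqP//|/eqP bm].
  have p : 0 <= coef_a c 0 2 / 2 * J 1 1 ^+ 2.
    by rewrite mulr_ge0 ?sqr_ge0// divr_ge0// ltW.
  move: h p a02'; rewrite bm mulN1r; move: (coef_a c 0 2 / 2 * J 1 1 ^+ 2) => z h p a02p; exfalso; lra.
have b11 : B 0 0 = B 1 1.
  have b11s : B 1 1 ^+ 2 = 1 by have := BOE 1 1; rewrite b10 b12 !mul0r !addr0 add0r eqxx.
  have := Bdet; rewrite det_mx3 b01 b02 b12 b22 => d.
  by rewrite !expr2 in b00s b11s; nra.
(* The directions (1, 0) and (1, 1) determine J 0 1 and J 1 1; positivity of det J then excludes J 0
   0 = -1. *)
have q (al eta : R) : al * B 1 1 * J 0 0 * (al * J 0 1 + eta * J 1 1) = al * eta.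
  by rewrite -[RHS](ray_quadratic_y _ _ b01) b21 j10; ring.
have bj : B 1 1 * J 0 0 = 1 by rewrite -b11.
have j01 : J 0 1 = 0 by have := q 1 0; rewrite !mul1r bj mul0r addr0 mul1r.
have j11' : J 1 1 = 1 by have := q 1 1; rewrite !mul1r bj j01 add0r mul1r.
have j001 : J 0 0 = 1.
  rewrite j11' mulr1 in dJ; rewrite -b11 in bj.
  by rewrite expr2 in b00s; nra.
split; last by [].
have b001 : B 0 0 = 1 by rewrite j001 mulr1 in b00.
have b11e : B 1 1 = 1 by rewrite -b11.
apply/matrixP => i j; move: i j.
by apply: forall_ord3; apply: forall_ord3; rewrite [RHS]mxE /=
  ?b001 ?b01 ?b02 ?b10 ?b11e ?b12 ?b20 ?b21 ?b22.
Qed.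

(** The ray (0, 1) gives b_3 first, because its equality is an input to the comparison of the third
    components along the rays (1, eta). *)
Lemma rigid_jets : [/\ coef_b c 3 = coef_b c' 3, coef_a c 1 2 = coef_a c' 1 2
  & coef_a c 0 3 = coef_a c' 0 3].
Proof.
have [BE [j00 j10 j01 j11]] := rigid_linear_part.
have cub al eta : exists (P Q E0 E1 E2 : R -> R) (K' : R),
  [/\ P r @[r --> 0^'] --> al, Q r @[r --> 0^'] --> eta,
    [/\ \forall r \near 0^', `|E0 r| <= K',
      \forall r \near 0^', `|E1 r| <= K' & \forall r \near 0^', `|E2 r| <= K']
  & [/\ \forall r \near 0^', r * P r - r * al = r ^+ 4 * E0 r,
    \forall r \near 0^',
      jety c (r * P r) (r * Q r) - jety c' (r * al) (r * eta) = r ^+ 4 * E1 r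
  & \forall r \near 0^',
      jetz c (r * P r) (r * Q r) - jetz c' (r * al) (r * eta) = r ^+ 4 * E2 r]].
  have [P [Q [E [K' [Pl Ql EK eqE]]]]] := ray_data al eta.
  rewrite j00 j10 mulr1 mulr0 addr0 in Pl; rewrite j01 j11 mulr1 mulr0 add0r in Ql.
  exists P, Q, (E 0), (E 1), (E 2%:R), K'; split => //.
  split.
  - by apply: filterS (eqE 0) => r <-; rewrite BE !mxE /=; ring.
  - by apply: filterS (eqE 1) => r <-; rewrite BE !mxE /=; ring.
  - by apply: filterS (eqE 2%:R) => r <-; rewrite BE !mxE /=; ring.
have bE : coef_b c 3 = coef_b c' 3.
  have [P [Q [E0 [E1 [E2 [K' [Pl Ql [e0 e1 e2] [q0 q1 q2]]]]]]]] := cub 0 1.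
  have := ray_order3_b Ql e0 e1 q0 q1 erefl.
  by rewrite expr1n !mulr1; lra.
have b02 : B 0 2%:R = 0 by rewrite BE mxE.
have b12 : B 1 2%:R = 0 by rewrite BE mxE.
have b22 : B 2%:R 2%:R = 1 by rewrite BE mxE.
have J3 eta : jet3 c 1 eta = jet3 c' 1 eta.
  have [P [Q [E0 [E1 [E2 [K' [Pl Ql [e0 e1 e2] [q0 q1 q2]]]]]]]] := cub 1 eta.
  apply: (ray_order3_z Pl Ql e0 e1 e2 q0 q1 q2) => //; first by rewrite bE.
  have := ray_quadratic_z 1 eta b02; rewrite b12 b22 j00 j10 j01 j11.
  by rewrite !(mulr0, mul0r, mul1r, mulr1, addr0, add0r).
(* Four values determine the coefficients of a cubic polynomial in eta. *)
have := J3 0; have := J3 1; have := J3 (-1); have := J3 2.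
by rewrite /jet3 => h1 h2 h3 h4; split => //; lra.
Qed.

End Rigidity.
End Rigid.

Section NormalFormUnique.
Variable R : realType.
Implicit Types (c : coefs R).

Lemma monomial_bound (x : 'rV[R]_2) j r : `|x| <= 1 -> (j <= r)%N -> (4 <= r)%N ->
  `|x 0 0 ^+ j * x 0 1 ^+ (r - j)| <= `|x| ^+ 4.
Proof.
move=> x1 jr r4; rewrite normrM !normrX.
apply: le_trans (_ : `|x| ^+ r <= _); last first.
  by rewrite -(subnKC r4) exprD ler_piMr ?exprn_ge0// exprn_ile1.
rewrite -{2}(subnKC jr) exprD ler_pM ?exprn_ge0// lerXn2r ?nnegrE//;
  exact: rV_norm_coord.
Qed.

Lemma normal_jet_cubic n c : (3 <= n)%N ->
  exists K, \forall x \near (0 : 'rV[R]_2),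
    `|normal_jet n c x - cubic_jet c x| <= K * `|x| ^+ 4.
Proof.
move=> n3.
pose K1 := \sum_(4 <= i < n.+1) `|coef_b c i / i`!%:R|.
pose K2 := \sum_(4 <= r < n.+1) \sum_(0 <= j < r.+1)
   `|coef_a c j (r - j) / (j`!%:R * (r - j)`!%:R)|.
have K10 : 0 <= K1 by apply: sumr_ge0.
have K20 : 0 <= K2 by apply: sumr_ge0 => r _; apply: sumr_ge0.
exists (K1 + K2).
have : \forall x \near (0 : 'rV[R]_2), `|x| < 1 by exact: nbhs0_lt.
apply: filterS => x /ltW x1.
have x4 : 0 <= `|x| ^+ 4 by exact: exprn_ge0.
apply: rV_norm_le => [|j]; first by rewrite mulr_ge0// addr_ge0.
have H1 : `|\sum_(4 <= i < n.+1) coef_b c i / i`!%:R * x 0 1 ^+ i| <= K1 * `|x| ^+ 4.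
  apply: le_trans (ler_norm_sum _ _ _) _; rewrite mulr_suml.
  rewrite big_nat [leRHS]big_nat; apply: ler_sum => i /andP[i4 _].
  rewrite normrM ler_wpM2l//.
  by have := @monomial_bound x 0 i x1 (leq0n i) i4; rewrite expr0 mul1r subn0.
have H2 : `|\sum_(4 <= r < n.+1) \sum_(0 <= j < r.+1)
    coef_a c j (r - j) / (j`!%:R * (r - j)`!%:R) * x 0 0 ^+ j * x 0 1 ^+ (r - j)|
    <= K2 * `|x| ^+ 4.
  apply: le_trans (ler_norm_sum _ _ _) _; rewrite mulr_suml.
  rewrite big_nat [leRHS]big_nat; apply: ler_sum => r /andP[r4 _].
  apply: le_trans (ler_norm_sum _ _ _) _; rewrite mulr_suml.
  rewrite big_nat [leRHS]big_nat; apply: ler_sum => i /andP[_ ir].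
  by rewrite -mulrA normrM ler_wpM2l// monomial_bound.
have le1 (z : R) : `|z| <= K1 * `|x| ^+ 4 -> `|z| <= (K1 + K2) * `|x| ^+ 4.
  by move=> h; apply: le_trans h _; rewrite mulrDl lerDl mulr_ge0.
have le2 (z : R) : `|z| <= K2 * `|x| ^+ 4 -> `|z| <= (K1 + K2) * `|x| ^+ 4.
  by move=> h; apply: le_trans h _; rewrite mulrDl lerDr mulr_ge0.
move: j; apply: forall_ord3.
- rewrite !mxE /= /ucoord subrr normr0 mulr_ge0// addr_ge0//.
- apply: le1; apply: le_trans H1; rewrite le_eqVlt; apply/orP; left; apply/eqP; congr `|_|.
  rewrite !mxE /= /ucoord /vcoord /jety big_ltn//.
  by rewrite !factS fact0; field.
- apply: le2; apply: le_trans H2; rewrite le_eqVlt; apply/orP; left; apply/eqP; congr `|_|.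
  rewrite !mxE /= /ucoord /vcoord /jetz [in LHS]big_ltn; last by rewrite ltnS ltnW.
  rewrite [X in _ + X - _]big_ltn; last by rewrite ltnS.
  set T := \sum_(4 <= i < _) _; move: T => T.
  rewrite !big_nat_recl// !big_geq// /jet2 /jet3 ?subn0 ?subSS ?subn0 !factS !fact0.
  by rewrite !expr0 !expr1; field.
Qed.

Lemma mulmx_inj_eq n m (M N : 'M[R]_(n, m)) :
  (forall v : 'rV_n, v *m M = v *m N) -> M = N.
Proof. by move=> H; apply/row_matrixP => i; rewrite (rowE i M) (rowE i N). Qed.

Lemma jacobian_comp n m l (f : 'rV[R]_n -> 'rV[R]_m) (g : 'rV[R]_m -> 'rV[R]_l) x :
  differentiable f x -> differentiable g (f x) ->
  'J (fun y => g (f y)) x = 'J f x *m 'J g (f x).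
Proof.
move=> df dg; have dc : differentiable (fun y => g (f y)) x.
  exact: (@differentiable_comp _ _ _ _ f g).
apply: mulmx_inj_eq => v.
apply: etrans (esym (deriveEjacobian v dc)) _; rewrite mulmxA.
apply: etrans (congr1 (mulmx^~ ('J g (f x))) (deriveEjacobian v df)).
apply: etrans (deriveEjacobian _ dg).
by rewrite (deriveE _ dc) (@diff_comp _ _ _ _ f g _ df dg)/= -(deriveE _ df) -(deriveE _ dg).
Qed.

Lemma near_eq_jacobian n m (f g : 'rV[R]_n -> 'rV[R]_m) x :
  differentiable f x -> (\forall y \near x, f y = g y) -> 'J f x = 'J g x.
Proof.
move=> df fg; have dg := near_eq_differentiable fg df.
apply: mulmx_inj_eq => v; apply: etrans (esym (deriveEjacobian v df)) _.
by apply: etrans (deriveEjacobian v dg); exact: near_eq_derive.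
Qed.

Lemma has_normal_form_cubic n f p c : (3 <= n)%N -> has_normal_form n f p c ->
  0 < coef_a c 0 2 /\ exists (A : 'M[R]_3) (w : 'rV[R]_3) (phi : 'rV[R]_2 -> 'rV[R]_2) (K : R),
  [/\ A *m A^T = 1%:M /\ \det A = 1, local_diffeo phi 0 /\ phi 0 = p, 0 < \det ('J phi 0), 0 <= K
    & \forall x \near (0 : 'rV[R]_2),
      `|f (phi x) *m A + w - cubic_jet c x| <= K * `|x| ^+ 4].
Proof.
move=> n3 [a02 [A [w [phi [AO phiD dphi H]]]]]; split=> //.
have [K0 HK0] := normal_jet_cubic c n3.
move/eqO_exP : H => [k k0 Hk].
exists A, w, phi, (k + `|K0|); split => //; first by rewrite addr_ge0// ltW.
have x1 : \forall x \near (0 : 'rV[R]_2), `|x| < 1 by exact: nbhs0_lt.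
apply: filterS3 Hk HK0 x1 => x h1 h2 /ltW h3.
rewrite -[X in X - _](subrK (normal_jet n c x)) -addrA.
apply: le_trans (ler_normD _ _) _; rewrite mulrDl; apply: lerD; last first.
  by apply: le_trans h2 _; rewrite ler_wpM2r ?exprn_ge0// ler_norm.
apply: le_trans h1 _; rewrite ler_pM2l// ger0_norm ?exprn_ge0//.
by apply: ler_wiXn2l.
Qed.

(** Eliminating f between the two normal forms leaves a relation between the two jets alone, through
    psi = phi^-1 o phi' and the rotation A^T A'. Orientation is inherited from the factors. *)
Lemma normal_form_unique n n' f p c c' : (3 <= n)%N -> (3 <= n')%N ->
  has_normal_form n f p c -> has_normal_form n' f p c' ->
  [/\ coef_b c 3 = coef_b c' 3, coef_a c 1 2 = coef_a c' 1 2
  & coef_a c 0 3 = coef_a c' 0 3].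
Proof.
move=> n3 n3' /(has_normal_form_cubic n3)[a02 [A [w [phi [K [[AO dA] [pD p0] dp K0 HK]]]]]].
move=> /(has_normal_form_cubic n3')[a02' [A' [w' [phi' [K' [[AO' dA'] [pD' p0'] dp' K0' HK']]]]]].
have [D [g [[oD D0] oE sphi sg gK]]] := pD.
have [D' [g' [[oD' D0'] oE' sphi' sg' gK']]] := pD'.
pose psi x := g (phi' x).
have pE : (phi @` D) p by exists 0.
have [phid _] := sphi 1; have [phid' _] := sphi' 1; have [gd _] := sg 1.
have dphi0 := phid 0 D0; have dphi0' := phid' 0 D0'.
have dg : differentiable g (phi' 0) by rewrite p0'; exact: gd.
have psid : differentiable psi 0 by apply: (@differentiable_comp _ _ _ _ phi' g).
have psi0 : psi 0 = 0 by rewrite /psi p0' -p0 gK.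
have nD' : \forall x \near (0 : 'rV[R]_2), (phi @` D) (phi' x).
  have cphi : {for 0, continuous phi'} by exact: differentiable_continuous.
  have nE : nbhs (phi' 0) (phi @` D) by apply: open_nbhs_nbhs; rewrite p0'.
  exact: (cphi _ nE).
have phiE : \forall x \near (0 : 'rV[R]_2), phi (psi x) = phi' x.
  by apply: filterS nD' => x [y Dy yE]; rewrite /psi -yE gK.
have dphi1 : differentiable phi (psi 0) by rewrite psi0.
have Jpsi : 'J psi 0 *m 'J phi 0 = 'J phi' 0.
  have := jacobian_comp psid dphi1; rewrite psi0 => <-.
  apply: near_eq_jacobian phiE.
  by apply: (@differentiable_comp _ _ _ _ psi phi).
have dpsi : 0 < \det ('J psi 0).
  by move: dp'; rewrite -Jpsi det_mulmx pmulr_lgt0.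
have AO2 : A^T *m A = 1%:M by exact: mulmx1C.
have AO2' : A'^T *m A' = 1%:M by exact: mulmx1C.
pose B := A^T *m A'.
have BO : B *m B^T = 1%:M.
  by rewrite /B trmx_mul trmxK mulmxA -(mulmxA A^T) AO' mulmx1.
have dB : \det B = 1 by rewrite /B det_mulmx det_tr dA dA' mulr1.
have [C C0 HC] := mulmx_norm_le B.
(* This converts the remainder of the first normal form, of order |psi x|^4, into one of order
   |x|^4. *)
have [k k0 Hk] : exists2 k, 0 < k & \forall x \near (0 : 'rV[R]_2), `|psi x| <= k * `|x|.
  have [k k0 kJ] := mulmx_norm_le ('J psi 0).
  exists (k + 1); first by rewrite addr_gt0.
  apply: filterS (diff_norm psid (@ltr01 R)) => x.
  rewrite addr0 psi0 subr0 -(deriveE _ psid) (deriveEjacobian _ psid) => h.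
  rewrite -[psi x](subrK (x *m 'J psi 0)); apply: le_trans (ler_normD _ _) _.
  by rewrite addrC mulrDl lerD.
have psic : {for 0, continuous psi} by exact: differentiable_continuous.
apply: (@rigid_jets R c c' B (w' - w *m B) psi (C * (K * k ^+ 4) + K')) => //.
have HK1 : \forall x \near (0 : 'rV[R]_2),
    `|f (phi (psi x)) *m A + w - cubic_jet c (psi x)| <= K * `|psi x| ^+ 4.
  by rewrite -psi0 in HK; exact: (psic _ HK).
near=> x.
have e : phi (psi x) = phi' x by near: x.
have h1 : `|f (phi (psi x)) *m A + w - cubic_jet c (psi x)| <= K * `|psi x| ^+ 4 by near: x.
have h2 : `|f (phi' x) *m A' + w' - cubic_jet c' x| <= K' * `|x| ^+ 4 by near: x.
have h3 : `|psi x| <= k * `|x| by near: x.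
have -> : cubic_jet c (psi x) *m B + (w' - w *m B) - cubic_jet c' x
   = (f (phi' x) *m A' + w' - cubic_jet c' x)
     - (f (phi (psi x)) *m A + w - cubic_jet c (psi x)) *m B.
  have fB : f (phi' x) *m A *m B = f (phi' x) *m A'.
    by rewrite /B mulmxA -(mulmxA _ A A^T) AO mulmx1.
  have Z (a b d q z : 'rV[R]_3) : b + (z - d) - q = (a + z - q) - (a + d - b).
    by apply/rowP => i; rewrite !mxE; ring.
  by rewrite e mulmxBl mulmxDl fB; exact: Z.
apply: le_trans (ler_normB _ _) _; rewrite addrC mulrDl; apply: lerD => //.
apply: le_trans (HC _) _; rewrite -mulrA ler_pM2l//.
apply: le_trans h1 _; rewrite -mulrA ler_wpM2l// -exprMn.
by rewrite lerXn2r ?nnegrE// mulr_ge0// ltW.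
Unshelve. all: by end_near. Qed.
End NormalFormUnique.

(** * The ruled surfaces and their metric *)

Section CoordinateCalculus.
Variable R : realType.
Implicit Types (V : normedModType R).

Lemma Ck_on_sin V k (D : set V) (g : V -> R) : open D -> Ck_on k D g -> Ck_on k D (fun x => sin (g x)).
Proof.
move=> oD gC; apply: (Ck_on_comp_R oD (E := setT)) gC _ => //.
by have [] := @Ck_on_sin_cos R k setT.
Qed.

Lemma Ck_on_cos V k (D : set V) (g : V -> R) : open D -> Ck_on k D g -> Ck_on k D (fun x => cos (g x)).
Proof.
move=> oD gC; apply: (Ck_on_comp_R oD (E := setT)) gC _ => //.
by have [] := @Ck_on_sin_cos R k setT.
Qed.

Lemma Ck_on_row3 V k (D : set V) (f g h : V -> R) : open D ->
  Ck_on k D f -> Ck_on k D g -> Ck_on k D h -> Ck_on k D (fun x => row3 (f x) (g x) (h x)).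
Proof.
move=> oD fC gC hC; apply: Ck_on_rV => //; apply: forall_ord3.
- by apply: Ck_on_eq oD _ fC => x _; rewrite row3E.
- by apply: Ck_on_eq oD _ gC => x _; rewrite row3E.
- by apply: Ck_on_eq oD _ hC => x _; rewrite row3E.
Qed.

Lemma Ck_on_id V n (D : set V) : Ck_on n D (fun x => x).
Proof. by apply: (@Ck_on_lin R _ _ _ _ idfun) => x; exact: cvg_id. Qed.

Lemma derive_line V (W : normedModType R) (f : V -> W) x v :
  'D_v f x = 'D_1 (fun h : R => f (h *: v + x)) 0.
Proof.
rewrite /derive; set g1 := fun h => h^-1 *: _; set g2 := fun h => h^-1 *: _.
suff -> : g1 = g2 by [].
by rewrite funeqE /g1 /g2 => h /=; rewrite addr0 scale0r add0r [h *: 1]mulr1.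
Qed.

(** Reduces every partial derivative below to the derivative at 0 of an explicit function of one
    variable. *)
Lemma is_derive_line V (f : V -> R) x v (g : R -> R) (d : R) :
  (forall h, f (h *: v + x) = g h) -> is_derive (0 : R) (1 : R) g d -> 'D_v f x = d.
Proof.
move=> fg [_ <-]; rewrite derive_line (_ : (fun h : R => f (h *: v + x)) = g)//.
exact/funext.
Qed.

Section OneVariable.
Variable z : R.
Implicit Types f g : R -> R.

Lemma is_deriveD1 f g df dg : is_derive z (1 : R) f df -> is_derive z (1 : R) g dg ->
  is_derive z (1 : R) (fun h => f h + g h) (df + dg).
Proof. exact: is_deriveD. Qed.

Lemma is_deriveN1 f df : is_derive z (1 : R) f df -> is_derive z (1 : R) (fun h => - f h) (- df).
Proof. exact: is_deriveN. Qed.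

Lemma is_deriveM1 f g df dg : is_derive z (1 : R) f df -> is_derive z (1 : R) g dg ->
  is_derive z (1 : R) (fun h => f h * g h) (f z * dg + g z * df).
Proof. exact: is_deriveM. Qed.

Lemma is_derive_comp1 f g df dg : is_derive z (1 : R) f df -> is_derive (f z) (1 : R) g dg ->
  is_derive z (1 : R) (fun h => g (f h)) (df * dg).
Proof.
by move=> fd gd; rewrite mulrC; exact: is_derive1_comp.
Qed.

Lemma is_derive_val f df df' : is_derive z (1 : R) f df -> df = df' -> is_derive z (1 : R) f df'.
Proof. by move=> + <-. Qed.

Lemma is_deriveX1 f df n : is_derive z (1 : R) f df ->
  is_derive z (1 : R) (fun h => f h ^+ n) (df * (n%:R * f z ^+ n.-1)).
Proof.
move=> fd; apply: (@is_derive_comp1 f (fun y => y ^+ n)) => //.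
apply: DeriveDef; first exact: exprn_derivable.
by rewrite exp_derive /GRing.scale /= mulr1.
Qed.

Lemma is_deriveV1 f df : f z != 0 -> is_derive z (1 : R) f df ->
  is_derive z (1 : R) (fun h => (f h)^-1) (- df / f z ^+ 2).
Proof.
move=> f0 [fd <-]; apply: DeriveDef; first exact: derivableV.
by rewrite deriveV// /GRing.scale /= mulNr mulrC mulNr.
Qed.

Lemma is_derive_sin1 f df : is_derive z (1 : R) f df ->
  is_derive z (1 : R) (fun h => sin (f h)) (df * cos (f z)).
Proof. by move=> fd; apply: is_derive_comp1. Qed.

Lemma is_derive_cos1 f df : is_derive z (1 : R) f df ->
  is_derive z (1 : R) (fun h => cos (f h)) (df * - sin (f z)).
Proof. by move=> fd; apply: is_derive_comp1. Qed.

Lemma is_derive_id1 : is_derive z (1 : R) (fun h : R => h) 1.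
Proof. exact: is_derive_id. Qed.

Lemma is_derive_mulr1 (c : R) : is_derive z (1 : R) ( *%R c) c.
Proof.
have H : is_derive z (1 : R) (fun h => c * h) (c * 1 + z * 0) by exact: is_deriveM1.
by rewrite mulr1 mulr0 addr0 in H.
Qed.

Lemma is_derive_addr1 (c : R) : is_derive z (1 : R) ( +%R c) 1.
Proof.
have H : is_derive z (1 : R) (fun h => c + h) (0 + 1) by exact: is_deriveD1.
by rewrite add0r in H.
Qed.
End OneVariable.

End CoordinateCalculus.

Ltac solve_Ck oD := repeat lazymatch goal with
  | H : Ck_on _ _ ?f |- Ck_on _ _ ?f => exact: H
  | |- Ck_on _ _ (fun _ => ?c) => exact: Ck_on_cst
  | |- Ck_on _ _ (fun x => row3 _ _ _) => apply: (Ck_on_row3 oD)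
  | |- Ck_on _ _ (fun x => _ + _) => apply: (Ck_onD oD)
  | |- Ck_on _ _ (fun x => - _) => apply: (Ck_onN oD)
  | |- Ck_on _ _ (fun x => _^-1) => apply: (Ck_onV oD)
  | |- Ck_on _ _ (fun x => _ * _) => apply: (Ck_onM oD)
  | |- Ck_on _ _ (fun x => _ ^+ _) => apply: (Ck_onX _ oD)
  | |- Ck_on _ _ (fun x => sin _) => apply: (Ck_on_sin oD)
  | |- Ck_on _ _ (fun x => cos _) => apply: (Ck_on_cos oD)
  | |- Ck_on _ _ (fun x => _ 0 _) => apply: (Ck_on_coord _ oD)
  | |- _ => first [exact: Ck_on_cst | eassumption]
  end.

Ltac solve_derive := repeat lazymatch goal with
  | H : is_derive ?z _ ?f _ |- is_derive ?z _ ?f _ => exact: H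
  | |- is_derive _ _ (fun _ => ?c) _ => exact: is_derive_cst
  | |- is_derive _ _ (fun h => h) _ => exact: is_derive_id1
  | |- is_derive _ _ (GRing.mul _) _ => exact: is_derive_mulr1
  | |- is_derive _ _ (+%R _) _ => exact: is_derive_addr1
  | |- is_derive _ _ (fun x => _ + _) _ => notypeclasses refine (is_deriveD1 _ _)
  | |- is_derive _ _ (fun x => - _) _ => notypeclasses refine (is_deriveN1 _)
  | |- is_derive _ _ (fun x => _ * _) _ => notypeclasses refine (is_deriveM1 _ _)
  | |- is_derive _ _ (fun x => _ ^+ _) _ => notypeclasses refine (is_deriveX1 _ _)
  | |- is_derive _ _ (fun x => sin _) _ => notypeclasses refine (is_derive_sin1 _)
  | |- is_derive _ _ (fun x => cos _) _ => notypeclasses refine (is_derive_cos1 _)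
  | |- is_derive _ _ (fun x => _^-1) _ => notypeclasses refine (is_deriveV1 _ _)
  end.

Section Family.
Variable R : realType.
Implicit Types (V : normedModType R).

(** Here xi(v) = (rho cos(v/rho), rho sin(v/rho), k), and gamma is integrated in closed form; the
    shift of u cancels the terms v cos(v/rho) and v sin(v/rho) with coefficient 3/5. The integration
    constants are left as they fall, so the origin goes to rho^2 (- 4/5 k, 3/5, 0). *)
Definition ruled (rho k : R) (x : 'rV[R]_2) : 'rV[R]_3 :=
  let u := x 0 0 in let v := x 0 1 in
  row3 (rho * ((u - 4 / 5 * rho * k) * cos (v / rho) - (3 / 5 * rho + 4 / 5 * k * v) * sin (v / rho)))
       (rho * ((u - 4 / 5 * rho * k) * sin (v / rho) + (3 / 5 * rho + 4 / 5 * k * v) * cos (v / rho)))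
       (k * (u - 3 / 5 * v) + 2 / 5 * rho * v ^+ 2).

Lemma Ck_on_ruled V n (D : set V) (rho k : V -> R) (x : V -> 'rV[R]_2) : open D ->
  (forall z, D z -> rho z != 0) ->
  Ck_on n D rho -> Ck_on n D k -> Ck_on n D x -> Ck_on n D (fun z => ruled (rho z) (k z) (x z)).
Proof.
move=> oD r0 rC kC xC; rewrite /ruled; solve_Ck oD.
Qed.

Lemma smooth_ruled (rho k : R) D : open D -> rho != 0 -> smooth_on D (ruled rho k).
Proof.
move=> oD r0 n; apply: (@Ck_on_ruled _ n D (fun=> rho) (fun=> k) (fun x => x)) => //.
- exact: Ck_on_cst.
- exact: Ck_on_cst.
- exact: Ck_on_id.
Qed.

Section Partials.
Variables (rho k : R).
Hypotheses (r0 : 0 < rho) (rk : rho ^+ 2 + k ^+ 2 = 1).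

Let rn0 : rho != 0. Proof. by rewrite gt_eqF. Qed.

Lemma differentiable_ruled x : differentiable (ruled rho k) x.
Proof. by have [d _] := smooth_ruled k openT rn0 1; exact: d. Qed.

Lemma partial_u_ruled x : partial_u (ruled rho k) x =
  row3 (rho * cos (x 0 1 / rho)) (rho * sin (x 0 1 / rho)) k.
Proof.
rewrite /partial_u; set e := delta_mx _ _; apply/rowP.
have e0 h : (h *: e + x) 0 0 = h + x 0 0 by rewrite !mxE /= mulr1.
have e1 h : (h *: e + x) 0 1 = x 0 1 by rewrite !mxE /= mulr0 add0r.
have D := differentiable_ruled x.
apply: forall_ord3; rewrite row3E -(derive_coord _ _ D).
- eapply is_derive_line => [h|]; first by rewrite /ruled row3E e0 e1; reflexivity.
  by notypeclasses refine (is_derive_val _ _); [solve_derive|rewrite /=; ring].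
- eapply is_derive_line => [h|]; first by rewrite /ruled row3E e0 e1; reflexivity.
  by notypeclasses refine (is_derive_val _ _); [solve_derive|rewrite /=; ring].
- eapply is_derive_line => [h|]; first by rewrite /ruled row3E e0 e1; reflexivity.
  by notypeclasses refine (is_derive_val _ _); [solve_derive|rewrite /=; ring].
Qed.

(** In the moving frame this is - 3/5 e1 + u e2 + 4/5 v e3, while the u-derivative is e1. These
    frame coordinates are free of rho and k, hence so is the metric. *)
Lemma partial_v_ruled (x : 'rV[R]_2) : let u := x 0 0 in let v := x 0 1 in
  partial_v (ruled rho k) x =
  row3 (- (3 / 5 * rho + 4 / 5 * k * v) * cos (v / rho) - u * sin (v / rho))
       (u * cos (v / rho) - (3 / 5 * rho + 4 / 5 * k * v) * sin (v / rho))
       (- (3 / 5) * k + 4 / 5 * rho * v).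
Proof.
move=> u v; rewrite /partial_v; set e := delta_mx _ _; apply/rowP.
have e0 h : (h *: e + x) 0 0 = u by rewrite !mxE /= mulr0 add0r.
have e1 h : (h *: e + x) 0 1 = h + v by rewrite !mxE /= mulr1.
have D := differentiable_ruled x.
apply: forall_ord3; rewrite row3E -(derive_coord _ _ D).
- eapply is_derive_line => [h|]; first by rewrite /ruled row3E e0 e1; reflexivity.
  by notypeclasses refine (is_derive_val _ _); [solve_derive|rewrite /= add0r; field].
- eapply is_derive_line => [h|]; first by rewrite /ruled row3E e0 e1; reflexivity.
  by notypeclasses refine (is_derive_val _ _); [solve_derive|rewrite /= add0r; field].
- eapply is_derive_line => [h|]; first by rewrite /ruled row3E e0 e1; reflexivity.
  by notypeclasses refine (is_derive_val _ _); [solve_derive|rewrite /= add0r; field].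
Qed.

Lemma ruled_metric x :
  [/\ dot (partial_u (ruled rho k) x) (partial_u (ruled rho k) x) = 1,
      dot (partial_u (ruled rho k) x) (partial_v (ruled rho k) x) = - (3 / 5)
    & dot (partial_v (ruled rho k) x) (partial_v (ruled rho k) x)
      = x 0 0 ^+ 2 + 9 / 25 + 16 / 25 * x 0 1 ^+ 2].
Proof.
have cs := cos2Dsin2 (x 0 1 / rho).
rewrite partial_u_ruled partial_v_ruled /dot !sum_ord3 !row3E.
move: cs rk; set C := cos _; set S := sin _; move: C S => C S cs rk'.
split.
- have -> : rho * C * (rho * C) + rho * S * (rho * S) + k * k =
     rho ^+ 2 * (C ^+ 2 + S ^+ 2) + k ^+ 2 by ring.
  by rewrite cs mulr1.
- have -> : rho * C * (- (3 / 5 * rho + 4 / 5 * k * x 0 1) * C - x 0 0 * S) +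
    rho * S * (x 0 0 * C - (3 / 5 * rho + 4 / 5 * k * x 0 1) * S) +
    k * (- (3 / 5) * k + 4 / 5 * rho * x 0 1) =
    - (3 / 5) * (rho ^+ 2 * (C ^+ 2 + S ^+ 2) + k ^+ 2)
    + 4 / 5 * rho * k * x 0 1 * (1 - (C ^+ 2 + S ^+ 2)) by ring.
  by rewrite cs mulr1 rk' mulr1 subrr mulr0 addr0.
- have -> : x 0 0 ^+ 2 + 9 / 25 + 16 / 25 * x 0 1 ^+ 2 =
    x 0 0 ^+ 2 * (C ^+ 2 + S ^+ 2) + (9 / 25 + 16 / 25 * x 0 1 ^+ 2) * (rho ^+ 2 + k ^+ 2).
    by rewrite cs rk' !mulr1 addrA.
  have k2 : k ^+ 2 = 1 - rho ^+ 2 by rewrite -rk' addrC addKr.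
  have -> : S ^+ 2 = 1 - C ^+ 2 by rewrite -cs addrC addKr.
  have S2 : S ^+ 2 = 1 - C ^+ 2 by rewrite -cs addrC addKr.
  rewrite (_ : (- (3 / 5 * rho + 4 / 5 * k * x 0 1) * C - x 0 0 * S) *
    (- (3 / 5 * rho + 4 / 5 * k * x 0 1) * C - x 0 0 * S) +
    (x 0 0 * C - (3 / 5 * rho + 4 / 5 * k * x 0 1) * S) *
    (x 0 0 * C - (3 / 5 * rho + 4 / 5 * k * x 0 1) * S) +
    (- (3 / 5) * k + 4 / 5 * rho * x 0 1) * (- (3 / 5) * k + 4 / 5 * rho * x 0 1) =
    (x 0 0 ^+ 2 + (3 / 5 * rho + 4 / 5 * k * x 0 1) ^+ 2) * (C ^+ 2 + S ^+ 2) +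
    (- (3 / 5) * k + 4 / 5 * rho * x 0 1) ^+ 2); last by ring.
  by rewrite S2; field.
Qed.
End Partials.
End Family.

(** * Cross cap singularities *)

Section CrossCap.
Variable R : realType.
Implicit Types (V : normedModType R).

(** It is easier to exhibit parametrizations with f o chi = Psi o f_std; the charts of the
    definition are their local inverses. *)
Lemma cross_cap_param (f : 'rV[R]_2 -> 'rV[R]_3) (p : 'rV[R]_2)
    (chi : 'rV[R]_2 -> 'rV[R]_2) (Psi : 'rV[R]_3 -> 'rV[R]_3) :
  singular_point f p ->
  local_diffeo chi 0 -> chi 0 = p -> local_diffeo Psi 0 -> Psi 0 = f p ->
  (\forall y \near (0 : 'rV[R]_2), f (chi y) = Psi (f_std y)) ->
  cross_cap f p.
Proof.
move=> sp cD c0 PD P0 H; split => //.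
have sym (n : nat) (F : 'rV[R]_n -> 'rV[R]_n) : local_diffeo F 0 ->
    exists (A : set 'rV[R]_n) (G : 'rV[R]_n -> 'rV[R]_n),
    [/\ local_diffeo G (F 0), open A /\ A 0, forall x, A x -> G (F x) = x,
      open (F @` A) & {for F 0, continuous G}].
  move=> [A [G [[oA A0] oFA sF sG GK]]]; exists A, G; split => //.
    exists (F @` A), F; split => //.
    - rewrite (_ : _ @` _ = A)//; apply/seteqP; split => [_ [_ [x Ax <-] <-]|x Ax].
        by rewrite GK.
      by exists (F x); [exists x|rewrite GK].
    - rewrite (_ : _ @` _ = A)//; apply/seteqP; split => [_ [_ [x Ax <-] <-]|x Ax].
        by rewrite GK.
      by exists (F x); [exists x|exact: GK].
    - by move=> _ [x Ax <-]; rewrite GK.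
  have FA0 : (F @` A) (F 0) by exact: imageP.
  exact: (sG 0%N _ FA0).
have [A [G [GD [oA A0] GK oFA cG]]] := sym _ _ cD.
have [A' [G' [GD' [oA' A0'] GK' oFA' cG']]] := sym _ _ PD.
have G0 : G p = 0 by rewrite -c0 GK.
rewrite c0 in GD cG; rewrite P0 in GD'.
exists G, G'; split => //.
  by split => //; rewrite -P0 GK'.
have fA : \forall y \near (0 : 'rV[R]_2), A' (f_std y).
  have fc : {for (0 : 'rV[R]_2), continuous (@f_std R)}.
    have oT := @openT 'rV[R]_2.
    suff : Ck_on 0 setT (@f_std R) by apply.
    rewrite /f_std /ucoord /vcoord; apply: (Ck_on_row3 oT).
    - exact/(Ck_on_coord _ oT)/Ck_on_id.
    - by apply: (Ck_onM oT); exact/(Ck_on_coord _ oT)/Ck_on_id.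
    - by apply: (Ck_onX _ oT); exact/(Ck_on_coord _ oT)/Ck_on_id.
  apply: (fc A'); apply: open_nbhs_nbhs; split => //.
  suff -> : f_std (0 : 'rV[R]_2) = 0 by [].
  apply/rowP; apply: forall_ord3; rewrite !mxE /= /ucoord /vcoord !mxE //.
  - by rewrite mulr0.
  - by rewrite expr0n.
have Gp (P : 'rV[R]_2 -> Prop) : (\forall y \near (0 : 'rV[R]_2), P y) ->
    \forall x \near p, P (G x).
  by rewrite -G0 => nP; exact: (cG _ nP).
have pA : \forall x \near p, (chi @` A) x.
  by apply: open_nbhs_nbhs; split => //; exists 0.
have H' := Gp _ H; have fA' := Gp _ fA.
near=> x.
have h1 : f (chi (G x)) = Psi (f_std (G x)) by near: x.
have h2 : A' (f_std (G x)) by near: x.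
have [y Ay yx] : (chi @` A) x by near: x.
by rewrite -(GK' _ h2) -h1 -yx GK.
Unshelve. all: by end_near. Qed.

Lemma rank_lt2 m (M : 'M[R]_(2, m)) (w : 'rV[R]_2) : w != 0 -> w *m M = 0 -> (\rank M < 2)%N.
Proof.
move=> w0 wM; rewrite ltnNge; apply/negP => rk.
have Mf : row_free M by rewrite /row_free eqn_leq rank_leq_row.
move/eqP: wM; rewrite mulmx_free_eq0// => /eqP w00.
by rewrite w00 eqxx in w0.
Qed.

Lemma singular_ruled (rho k : R) : 0 < rho -> singular_point (ruled rho k) 0.
Proof.
move=> r0; rewrite /singular_point.
have D := differentiable_ruled k r0 0.
(* At the origin f_v = - 3/5 f_u, so this direction spans the kernel. *)
pose w : 'rV[R]_2 := 3 / 5 *: delta_mx 0 0 + delta_mx 0 1.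
apply: (@rank_lt2 _ _ w).
  by apply/negP => /eqP/rowP/(_ 1)/eqP; rewrite !mxE /= mulr0 add0r oner_eq0.
rewrite -(deriveEjacobian w D) (deriveE _ D) /w linearD linearZ /=.
rewrite -!(deriveE _ D) -/(partial_u _ _) -/(partial_v _ _).
rewrite partial_u_ruled// partial_v_ruled//.
by apply/rowP; apply: forall_ord3; rewrite !mxE /= ?mul0r ?cos0 ?sin0; ring.
Qed.
End CrossCap.

(** * Explicit cross cap coordinates for the ruled surfaces *)

Section RuledCrossCap.
Variable R : realType.
Implicit Types (V : normedModType R).

Lemma psum0 (c : nat -> R) : inv_fact_bounded c -> psum c 0 = c 0%N.
Proof. by move=> cb; rewrite psum_shift// mul0r addr0. Qed.

Lemma cosq0 : cosq 0 = 1 :> R.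
Proof. by rewrite /cosq (psum0 (cosq_bounded R)) double0 fact0 expr0 divr1. Qed.

Lemma sinq0 : sinq 0 = 1 :> R.
Proof. by rewrite /sinq (psum0 (sinq_bounded R)) double0 factS fact0 expr0 divr1. Qed.

Lemma is_derive_cosq0 : is_derive (0 : R) (1 : R) (fun h => cosq h) (- 2^-1).
Proof.
have := is_derive_psum (0 : R) (cosq_bounded R).
rewrite (psum0 (inv_fact_bounded_diffs (cosq_bounded R))).
move=> /is_derive_val; apply.
by rewrite /pseries_diffs !doubleS double0 !factS fact0 expr1; field.
Qed.

Lemma is_derive_sinq0 : is_derive (0 : R) (1 : R) (fun h => sinq h) (- 6^-1).
Proof.
have := is_derive_psum (0 : R) (sinq_bounded R).
rewrite (psum0 (inv_fact_bounded_diffs (sinq_bounded R))).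
move=> /is_derive_val; apply.
by rewrite /pseries_diffs !doubleS double0 !factS fact0 expr1; field.
Qed.

Section Params.
Variables (rho k : R).
Hypotheses (r0 : 0 < rho) (rk : rho ^+ 2 + k ^+ 2 = 1).

Let rn0 : rho != 0. Proof. by rewrite gt_eqF. Qed.
(** With th = v / rho, the components of [ruled] are rho ((u - D) cos th - (B + D th) sin th), rho
    ((u - D) sin th + (B + D th) cos th) and k u - k B th + L th^2. *)
Let B := 3 / 5 * rho.
Let D := 4 / 5 * rho * k.
Let L := 2 / 5 * rho ^+ 3.

(* With v = rho (M + q) and u = p + U0 + q U1, the part of [ruled rho k] that is
   odd in q and independent of p is linear in U0 and U1; it vanishes exactly
   for the following M, U0, U1, as functions of s = q^2. *)
Definition cc_den s := k * D * sinq s + 2 * L * cosq s.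
Definition cc_M s := k * B * (cosq s - sinq s) / cc_den s.
Definition cc_U1 s := sinq s * (B + D * cc_M s) / cosq s.
Definition cc_U0 s := D * (1 - cosq s / sinq s).

Definition cc_dom := [set s : R | cosq s * sinq s * cc_den s != 0].

Lemma cc_domP s : cc_dom s -> [/\ cosq s != 0, sinq s != 0 & cc_den s != 0].
Proof. by rewrite /cc_dom /= !mulf_eq0 !negb_or => /andP[/andP[]]. Qed.

Lemma cc_den0 : cc_den 0 != 0.
Proof.
rewrite /cc_den cosq0 sinq0 /D /L !mulr1.
rewrite (_ : _ + _ = 4 / 5 * rho * (rho ^+ 2 + k ^+ 2)); last by ring.
by rewrite rk mulr1 !mulf_neq0.
Qed.

Lemma cc_dom0 : cc_dom 0.
Proof. by rewrite /cc_dom /= cosq0 sinq0 !mul1r cc_den0. Qed.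

Lemma Ck_on_cosq1 V n (E : set V) (g : V -> R) : open E -> Ck_on n E g -> Ck_on n E (fun x => cosq (g x)).
Proof. by move=> oE gC; apply: (Ck_on_comp_R oE (E := setT)) gC (@Ck_on_cosq R n setT). Qed.

Lemma Ck_on_sinq1 V n (E : set V) (g : V -> R) : open E -> Ck_on n E g -> Ck_on n E (fun x => sinq (g x)).
Proof. by move=> oE gC; apply: (Ck_on_comp_R oE (E := setT)) gC (@Ck_on_sinq R n setT). Qed.

Lemma open_cc_dom : open cc_dom.
Proof.
have gC : continuous (fun s => cosq s * sinq s * cc_den s).
  have : Ck_on 0 setT (fun s => cosq s * sinq s * cc_den s).
    have C1 : Ck_on 0 setT (fun s : R => cosq s) by exact: Ck_on_cosq.
    have C2 : Ck_on 0 setT (fun s : R => sinq s) by exact: Ck_on_sinq.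
    by have oT := @openT R; rewrite /cc_den; solve_Ck oT.
  by move=> H x; exact: H.
have -> : cc_dom = (fun s => cosq s * sinq s * cc_den s) @^-1` (~` [set 0]).
  by apply/seteqP; split=> x /eqP.
apply: open_comp; last exact/closed_openC/closed_eq.
by move=> x _; exact: gC.
Qed.

Section Ck.
Variables (V : normedModType R) (n : nat) (E : set V) (g : V -> R).
Hypotheses (oE : open E) (gE : forall x, E x -> cc_dom (g x)) (gC : Ck_on n E g).

Let C1 := Ck_on_cosq1 oE gC.
Let C2 := Ck_on_sinq1 oE gC.

Lemma Ck_on_cc_M : Ck_on n E (fun x => cc_M (g x)).
Proof.
rewrite /cc_M /cc_den; solve_Ck oE.
by move=> x /gE/cc_domP[].
Qed.

Lemma Ck_on_cc_U1 : Ck_on n E (fun x => cc_U1 (g x)).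
Proof.
have CM := Ck_on_cc_M; rewrite /cc_U1; solve_Ck oE.
by move=> x /gE/cc_domP[].
Qed.

Lemma Ck_on_cc_U0 : Ck_on n E (fun x => cc_U0 (g x)).
Proof.
rewrite /cc_U0; solve_Ck oE.
by move=> x /gE/cc_domP[].
Qed.
End Ck.

(* The double curve is p = 0; ruled rho k (cc_chi (p, q)) has the form
   A(q^2) + p B(q^2) + p q C(q^2), and cc_Psi (x, y, z) = A(z) + x B(z) + y C(z). *)
Definition cc_chi (y : 'rV[R]_2) : 'rV[R]_2 :=
  let p := y 0 0 in let q := y 0 1 in let s := q ^+ 2 in
  \row_j [:: p + cc_U0 s + q * cc_U1 s; rho * (cc_M s + q)]`_j.

Definition cc_Psi (y : 'rV[R]_3) : 'rV[R]_3 :=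
  let s := y 0 2%:R in
  let a := y 0 0 * cosq s + cosq s * (cc_U0 s - D) - s * sinq s * D in
  let b := y 0 1 * sinq s + cosq s * (B + D * cc_M s) + s * sinq s * cc_U1 s in
  row3 (rho * (a * cos (cc_M s) - b * sin (cc_M s)))
       (rho * (a * sin (cc_M s) + b * cos (cc_M s)))
       (k * y 0 0 + k * cc_U0 s - k * B * cc_M s + L * (cc_M s ^+ 2 + s)).

Lemma ruled_chi (y : 'rV[R]_2) : cc_dom (y 0 1 ^+ 2) ->
  ruled rho k (cc_chi y) = cc_Psi (f_std y).
Proof.
move=> /cc_domP[]; set p := y 0 0; set q := y 0 1; set s := q ^+ 2 => c0 s0 d0.
(* These are the coefficients of the odd part in q: [E1] and [E2] for the horizontal components in
   the frame turned by the angle M, [E3] for the height. Eliminating U1 from [E1] and [E3] is what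
   defines M. *)
have E1 : cosq s * cc_U1 s - sinq s * (B + D * cc_M s) = 0.
  by rewrite /cc_U1; field.
have E2 : cosq s * D + sinq s * (cc_U0 s - D) = 0.
  by rewrite /cc_U0; field.
have E3 : k * cc_U1 s - k * B + 2 * L * cc_M s = 0.
  rewrite /cc_U1 (_ : _ - _ + _ = (cc_den s * cc_M s - k * B * (cosq s - sinq s)) / cosq s).
    by rewrite /cc_M mulrCA mulfV// mulr1 subrr mul0r.
  by rewrite /cc_den; field.
have u : cc_chi y 0 0 = p + cc_U0 s + q * cc_U1 s by rewrite mxE.
have v : cc_chi y 0 1 = rho * (cc_M s + q) by rewrite mxE.
have vr : rho * (cc_M s + q) / rho = cc_M s + q by rewrite mulrAC mulfV// mul1r.
have S0 : f_std y 0 0 = p by rewrite mxE.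
have S1 : f_std y 0 1 = p * q by rewrite mxE.
have S2 : f_std y 0 2%:R = s by rewrite mxE.
rewrite /ruled /cc_Psi u v S0 S1 S2 vr cosD sinD (cos_cosq q) (sin_sinq q) -/s.
move: E1 E2 E3; move: (cc_U1 s) (cc_U0 s) (cc_M s) (cosq s) (sinq s) => U1 U0 M c sg E1 E2 E3.
apply/rowP; apply: forall_ord3; rewrite !row3E.
- move: (cos M) (sin M) => cM sM; apply/eqP; rewrite -subr_eq0; apply/eqP.
  transitivity (rho * q * (cM * (c * U1 - sg * (B + D * M)) - sM * (c * D + sg * (U0 - D)))).
    by rewrite /s /B /D; ring.
  by rewrite E1 E2 !mulr0 subr0 mulr0.
- move: (cos M) (sin M) => cM sM; apply/eqP; rewrite -subr_eq0; apply/eqP.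
  transitivity (rho * q * (sM * (c * U1 - sg * (B + D * M)) + cM * (c * D + sg * (U0 - D)))).
    by rewrite /s /B /D; ring.
  by rewrite E1 E2 !mulr0 addr0 mulr0.
- apply/eqP; rewrite -subr_eq0; apply/eqP.
  transitivity (q * (k * U1 - k * B + 2 * L * M)).
    by rewrite /s /B /L; ring.
  by rewrite E3 mulr0.
Qed.

Lemma cc_M0 : cc_M 0 = 0.
Proof. by rewrite /cc_M cosq0 sinq0 subrr mulr0 mul0r. Qed.

Lemma cc_U00 : cc_U0 0 = 0.
Proof. by rewrite /cc_U0 cosq0 sinq0 divr1 subrr mulr0. Qed.

Lemma cc_U10 : cc_U1 0 = B.
Proof. by rewrite /cc_U1 cosq0 sinq0 cc_M0 mulr0 addr0 divr1 mul1r. Qed.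

(** The derivatives of M and U1 at 0 are used only as unspecified numbers: they drop out of the
    Jacobian determinants. *)
Lemma is_derive_smooth (F : R -> R) : Ck_on 1 cc_dom F ->
  exists m, is_derive (0 : R) (1 : R) (fun h => F h) m.
Proof.
move=> [d _]; exists ('D_1 F 0); apply: DeriveDef => //.
by apply/diff_derivable/d; exact: cc_dom0.
Qed.

Lemma Ck_id n : Ck_on n cc_dom (fun x : R => x).
Proof. exact: Ck_on_id. Qed.

Lemma is_derive_cc_M : exists m, is_derive (0 : R) (1 : R) (fun h => cc_M h) m.
Proof. by apply: is_derive_smooth; apply: (Ck_on_cc_M open_cc_dom _ (Ck_id 1)). Qed.

Lemma is_derive_cc_U1 : exists m, is_derive (0 : R) (1 : R) (fun h => cc_U1 h) m.
Proof. by apply: is_derive_smooth; apply: (Ck_on_cc_U1 open_cc_dom _ (Ck_id 1)). Qed.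

Lemma is_derive_cc_U0 : is_derive (0 : R) (1 : R) (fun h => cc_U0 h) (D / 3).
Proof.
have H1 := is_derive_cosq0; have H2 := is_derive_sinq0.
rewrite /cc_U0; notypeclasses refine (is_derive_val _ _); first solve_derive.
  by rewrite sinq0.
by rewrite /= !cosq0 !sinq0; field.
Qed.

(** The inner derivative of h^2 vanishes at 0, so M and U0 contribute nothing to the differential of
    [cc_chi] at the origin. *)
Lemma is_derive_sq (F : R -> R) m : is_derive (0 : R) (1 : R) (fun h => F h) m ->
  is_derive (0 : R) (1 : R) (fun h => F (h ^+ 2)) 0.
Proof.
move=> Fm; notypeclasses refine (is_derive_val (@is_derive_comp1 _ 0 (fun h => h ^+ 2) F _ _ _ _) _).
- by notypeclasses refine (is_deriveX1 _ _); exact: is_derive_id1.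
- by rewrite expr0n; exact: Fm.
by rewrite /= expr1 mulr0 mulr0 mul0r.
Qed.

Lemma cc_chiE y : (cc_chi y 0 0 = y 0 0 + cc_U0 (y 0 1 ^+ 2) + y 0 1 * cc_U1 (y 0 1 ^+ 2))
  * (cc_chi y 0 1 = rho * (cc_M (y 0 1 ^+ 2) + y 0 1)).
Proof. by rewrite !mxE. Qed.

Lemma local_diffeo_chi : local_diffeo cc_chi 0.
Proof.
pose E := [set y : 'rV[R]_2 | cc_dom (y 0 1 ^+ 2)].
have oE : open E.
  rewrite (_ : E = (fun y : 'rV[R]_2 => y 0 1 ^+ 2) @^-1` cc_dom)//.
  apply: open_comp; last exact: open_cc_dom.
  have oT := @openT 'rV[R]_2.
  have : Ck_on 0 setT (fun y : 'rV[R]_2 => y 0 1 ^+ 2).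
    by apply: (Ck_onX _ oT); exact/(Ck_on_coord _ oT)/Ck_on_id.
  by move=> H x _; exact: H.
have E0 : E 0 by rewrite /E /= mxE expr0n; exact: cc_dom0.
have sE : smooth_on E cc_chi.
  move=> n; apply: (Ck_on_rV oE).
  have p0 : Ck_on n E (fun y : 'rV[R]_2 => y 0 0) by exact/(Ck_on_coord _ oE)/Ck_on_id.
  have p1 : Ck_on n E (fun y : 'rV[R]_2 => y 0 1) by exact/(Ck_on_coord _ oE)/Ck_on_id.
  have p2 : Ck_on n E (fun y : 'rV[R]_2 => y 0 1 ^+ 2) by exact: (Ck_onX _ oE).
  have EE x : E x -> cc_dom (x 0 1 ^+ 2) by [].
  have CM := Ck_on_cc_M oE EE p2.
  have CU0 := Ck_on_cc_U0 oE EE p2.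
  have CU1 := Ck_on_cc_U1 oE EE p2.
  have H0 : Ck_on n E (fun y => cc_chi y 0 0).
    have : Ck_on n E (fun y : 'rV[R]_2 => y 0 0 + cc_U0 (y 0 1 ^+ 2) + y 0 1 * cc_U1 (y 0 1 ^+ 2)) by solve_Ck oE.
    by apply: (Ck_on_eq oE) => y _; rewrite mxE.
  have H1 : Ck_on n E (fun y => cc_chi y 0 1).
    have : Ck_on n E (fun y : 'rV[R]_2 => rho * (cc_M (y 0 1 ^+ 2) + y 0 1)) by solve_Ck oE.
    by apply: (Ck_on_eq oE) => y _; rewrite mxE.
  by apply: forall_ord2.
apply: (inverse_function oE E0 sE).
have dE : differentiable cc_chi 0 by have [d _] := sE 1%N; exact: d.
have [m Mm] := is_derive_cc_M; have [m1 Mm1] := is_derive_cc_U1.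
have M2 := is_derive_sq Mm; have U12 := is_derive_sq Mm1.
have U02 := is_derive_sq is_derive_cc_U0.
have e00 (h : R) : (h *: delta_mx 0 0 + 0 : 'rV[R]_2) 0 0 = h by rewrite !mxE mulr1 addr0.
have e01 (h : R) : (h *: delta_mx 0 0 + 0 : 'rV[R]_2) 0 1 = 0 by rewrite !mxE mulr0 addr0.
have e10 (h : R) : (h *: delta_mx 0 1 + 0 : 'rV[R]_2) 0 0 = 0 by rewrite !mxE mulr0 addr0.
have e11 (h : R) : (h *: delta_mx 0 1 + 0 : 'rV[R]_2) 0 1 = h by rewrite !mxE mulr1 addr0.
have J00 : 'J cc_chi 0 0 0 = 1.
  rewrite jacobianE// -(derive_coord _ _ dE).
  eapply is_derive_line => [h|]; first by rewrite cc_chiE ?e00 ?e01; reflexivity.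
  by notypeclasses refine (is_derive_val _ _); [solve_derive|rewrite /=; ring].
have J01 : 'J cc_chi 0 0 1 = 0.
  rewrite jacobianE// -(derive_coord _ _ dE).
  eapply is_derive_line => [h|]; first by rewrite cc_chiE ?e00 ?e01; reflexivity.
  by notypeclasses refine (is_derive_val _ _); [solve_derive|rewrite /=; ring].
have J11 : 'J cc_chi 0 1 1 = rho.
  rewrite jacobianE// -(derive_coord _ _ dE).
  eapply is_derive_line => [h|]; first by rewrite cc_chiE ?e10 ?e11; reflexivity.
  by notypeclasses refine (is_derive_val _ _); [solve_derive|rewrite /=; ring].
by rewrite det_mx2 J00 J01 J11 mul0r subr0 mul1r.
Qed.

Lemma local_diffeo_Psi : local_diffeo cc_Psi 0.
Proof.
pose E := [set y : 'rV[R]_3 | cc_dom (y 0 2%:R)].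
have oE : open E.
  rewrite (_ : E = (fun y : 'rV[R]_3 => y 0 2%:R) @^-1` cc_dom)//.
  apply: open_comp; last exact: open_cc_dom.
  by move=> x _; exact: coord_continuous.
have E0 : E 0 by rewrite /E /= mxE; exact: cc_dom0.
have sE : smooth_on E cc_Psi.
  move=> n.
  have p0 : Ck_on n E (fun y : 'rV[R]_3 => y 0 0) by exact/(Ck_on_coord _ oE)/Ck_on_id.
  have p1 : Ck_on n E (fun y : 'rV[R]_3 => y 0 1) by exact/(Ck_on_coord _ oE)/Ck_on_id.
  have p2 : Ck_on n E (fun y : 'rV[R]_3 => y 0 2%:R) by exact/(Ck_on_coord _ oE)/Ck_on_id.
  have EE (x : 'rV[R]_3) : E x -> cc_dom (x 0 2%:R) by [].
  have CM := Ck_on_cc_M oE EE p2.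
  have CU0 := Ck_on_cc_U0 oE EE p2.
  have CU1 := Ck_on_cc_U1 oE EE p2.
  have C1 := Ck_on_cosq1 oE p2; have C2 := Ck_on_sinq1 oE p2.
  by rewrite /cc_Psi; solve_Ck oE.
apply: (inverse_function oE E0 sE).
have dE : differentiable cc_Psi 0 by have [d _] := sE 1%N; exact: d.
have [m Mm] := is_derive_cc_M; have [m1 Mm1] := is_derive_cc_U1.
have U0' := is_derive_cc_U0; have C' := is_derive_cosq0; have S' := is_derive_sinq0.
have ed (i j : 'I_3) (h : R) : (h *: delta_mx 0 i + 0 : 'rV[R]_3) 0 j = h * (j == i)%:R.
  by rewrite !mxE addr0.
have vals := (cosq0, sinq0, cc_M0, cc_U00, cc_U10, cos0, sin0).
have J00 : 'J cc_Psi 0 0 0 = rho.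
  rewrite jacobianE// -(derive_coord _ _ dE).
  eapply is_derive_line => [h|]; first by rewrite /cc_Psi row3E !ed /= !(mulr1, mulr0) !vals; reflexivity.
  by notypeclasses refine (is_derive_val _ _); [solve_derive|rewrite /=; ring].
have J01 : 'J cc_Psi 0 0 1 = 0.
  rewrite jacobianE// -(derive_coord _ _ dE).
  eapply is_derive_line => [h|]; first by rewrite /cc_Psi row3E !ed /= !(mulr1, mulr0) !vals; reflexivity.
  by notypeclasses refine (is_derive_val _ _); [solve_derive|rewrite /=; ring].
have J02 : 'J cc_Psi 0 0 2%:R = k.
  rewrite jacobianE// -(derive_coord _ _ dE).
  eapply is_derive_line => [h|]; first by rewrite /cc_Psi row3E !ed /= !(mulr1, mulr0) !vals; reflexivity.
  by notypeclasses refine (is_derive_val _ _); [solve_derive|rewrite /=; ring].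
have J10 : 'J cc_Psi 0 1 0 = 0.
  rewrite jacobianE// -(derive_coord _ _ dE).
  eapply is_derive_line => [h|]; first by rewrite /cc_Psi row3E !ed /= !(mulr1, mulr0) !vals; reflexivity.
  by notypeclasses refine (is_derive_val _ _); [solve_derive|rewrite /=; ring].
have J11 : 'J cc_Psi 0 1 1 = rho.
  rewrite jacobianE// -(derive_coord _ _ dE).
  eapply is_derive_line => [h|]; first by rewrite /cc_Psi row3E !ed /= !(mulr1, mulr0) !vals; reflexivity.
  by notypeclasses refine (is_derive_val _ _); [solve_derive|rewrite /=; ring].
have J12 : 'J cc_Psi 0 1 2%:R = 0.
  rewrite jacobianE// -(derive_coord _ _ dE).
  eapply is_derive_line => [h|]; first by rewrite /cc_Psi row3E !ed /= !(mulr1, mulr0) !vals; reflexivity.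
  by notypeclasses refine (is_derive_val _ _); [solve_derive|rewrite /=; ring].
have J20 : 'J cc_Psi 0 2%:R 0 = rho * (- (D / 6) - B * m).
  rewrite jacobianE// -(derive_coord _ _ dE).
  eapply is_derive_line => [h|]; first by rewrite /cc_Psi row3E !ed /= !(mulr1, mulr0); reflexivity.
  by notypeclasses refine (is_derive_val _ _); [solve_derive|rewrite /= !vals; field].
have J22 : 'J cc_Psi 0 2%:R 2%:R = k * D / 3 - k * B * m + L.
  rewrite jacobianE// -(derive_coord _ _ dE).
  eapply is_derive_line => [h|]; first by rewrite /cc_Psi row3E !ed /= !(mulr1, mulr0); reflexivity.
  by notypeclasses refine (is_derive_val _ _); [solve_derive|rewrite /= !vals; field].
rewrite det_mx3 J00 J01 J02 J10 J11 J12 J20 J22.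
(* The unknown [m] occurs in [J20] and [J22] and cancels. *)
rewrite (_ : _ + _ = 2 / 5 * rho ^+ 3 * (rho ^+ 2 + k ^+ 2)); last by rewrite /B /D /L; field.
by rewrite rk mulr1 !mulf_neq0 ?expf_neq0.
Qed.

Lemma cross_cap_ruled : cross_cap (ruled rho k) 0.
Proof.
have chi0 : cc_chi 0 = 0.
  apply/rowP; apply: forall_ord2; rewrite !mxE /= expr0n.
    by rewrite cc_U00 mul0r !addr0.
  by rewrite cc_M0 addr0 mulr0.
apply: (cross_cap_param (singular_ruled k r0) local_diffeo_chi chi0 local_diffeo_Psi).
  have := @ruled_chi 0; rewrite chi0 => ->; last by rewrite mxE expr0n; exact: cc_dom0.
  by congr cc_Psi; apply/rowP; apply: forall_ord3; rewrite !mxE /= /ucoord /vcoord !mxE ?mulr0 ?expr0n.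
have oT := @openT 'rV[R]_2.
have : Ck_on 0 setT (fun y : 'rV[R]_2 => y 0 1 ^+ 2).
  by apply: (Ck_onX _ oT); exact/(Ck_on_coord _ oT)/Ck_on_id.
move=> /(_ 0 I cc_dom); rewrite mxE expr0n /= => H.
have N : \forall y \near (0 : 'rV[R]_2), cc_dom ((y : 'rV[R]_2) 0 1 ^+ 2).
  exact: (H (open_nbhs_nbhs (conj open_cc_dom cc_dom0))).
by apply: filterS N => y; exact: ruled_chi.
Qed.
End Params.
End RuledCrossCap.

(** * Normal form of the ruled surfaces *)

Section NormalForm.
Variable R : realType.

Section Remainders.
Variables (kap U w : R).

(* nf_u, nf_v is the coordinate change, with w = 5/4 v; nf_G and nf_H are what is
   left of the cubic Taylor polynomial of the surface in the rotated frame after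
   this change, beyond its cubic jet. *)
Definition nf_v : R := w + 3 / 8 * kap * w ^+ 2.
Definition nf_u : R := 3 / 5 * nf_v + U + U * w ^+ 2 / 2 + w ^+ 3 / 5.

Definition nf_GX : R := - (3 / 8 * kap + 1 / 4 * w + 9 / 128 * kap ^+ 2 * w
  + 3 / 16 * kap * w ^+ 2 + 9 / 256 * kap ^+ 2 * w ^+ 3).
Definition nf_HX : R := - (9 / 40 * kap + 1 / 10 * w + 27 / 320 * kap ^+ 2 * w
  + 3 / 40 * kap * w ^+ 2 + 27 / 2560 * kap ^+ 3 * w ^+ 2 + 9 / 640 * kap ^+ 2 * w ^+ 3).
Definition nf_GY : R := 2 / 5 - 9 / 40 * kap ^+ 2 - 27 / 640 * kap ^+ 3 * w
  - 9 / 80 * kap ^+ 2 * w ^+ 2 - 27 / 1280 * kap ^+ 3 * w ^+ 3.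
Definition nf_HY : R := 4 / 25 - 3 / 8 * kap ^+ 2 - 9 / 64 * kap ^+ 3 * w
  - 9 / 200 * kap ^+ 2 * w ^+ 2 - 9 / 512 * kap ^+ 4 * w ^+ 2 - 27 / 3200 * kap ^+ 3 * w ^+ 3.
Definition nf_GZ : R := 3 / 10 + 3 / 10 * kap ^+ 2 + 5 / 16 * kap * w + 9 / 160 * kap ^+ 3 * w
  + 3 / 20 * kap ^+ 2 * w ^+ 2 + 9 / 320 * kap ^+ 3 * w ^+ 3.
Definition nf_HZ : R := 3 / 25 + 9 / 128 * kap ^+ 2 + 1 / 8 * kap * w
  + 3 / 50 * kap ^+ 2 * w ^+ 2 + 9 / 800 * kap ^+ 3 * w ^+ 3.

(** [nf_u] is designed for this: 3/5 v undoes the shift, and its cubic terms cancel those of the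
    tangential component. *)
Lemma nf_X : nf_u - 3 / 5 * nf_v - nf_u * nf_v ^+ 2 / 2 + nf_v ^+ 3 / 10
  = U + U * w ^+ 3 * nf_GX + w ^+ 4 * nf_HX.
Proof. by rewrite /nf_u /nf_v /nf_GX /nf_HX; field. Qed.

(** The quadratic term of [nf_v] is chosen so that no U w^2 remains here; w = 5/4 v then normalizes
    the coefficient of the mixed term to 1. *)
Lemma nf_Y : 4 / 5 * (nf_u * nf_v - 3 / 10 * nf_v ^+ 2 - 4 / 15 * kap * nf_v ^+ 3)
  - 3 / 5 * (2 / 5 * nf_v ^+ 2 + kap * nf_u * nf_v ^+ 2 / 2 - kap * nf_v ^+ 3 / 10)
  = 4 / 5 * U * w - 1 / 3 * kap * w ^+ 3 + U * w ^+ 3 * nf_GY + w ^+ 4 * nf_HY.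
Proof. by rewrite /nf_u /nf_v /nf_GY /nf_HY; field. Qed.

Lemma nf_Z : 3 / 5 * (nf_u * nf_v - 3 / 10 * nf_v ^+ 2 - 4 / 15 * kap * nf_v ^+ 3)
  + 4 / 5 * (2 / 5 * nf_v ^+ 2 + kap * nf_u * nf_v ^+ 2 / 2 - kap * nf_v ^+ 3 / 10)
  = 1 / 2 * w ^+ 2 + 3 / 5 * U * w + 5 / 8 * kap * U * w ^+ 2 + 3 / 8 * kap * w ^+ 3
    + U * w ^+ 3 * nf_GZ + w ^+ 4 * nf_HZ.
Proof. by rewrite /nf_u /nf_v /nf_GZ /nf_HZ; field. Qed.

(** These quotients show that v^4 and v^3 u lie in the ideal generated by U w^3 and w^4, where all
    remainders are kept. *)
Definition nf_nu : R := 1 + 3 / 8 * kap * w.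
Definition nf_mu1 : R := 1 + w ^+ 2 / 2.
Definition nf_mu2 : R := 3 / 5 * nf_nu + w ^+ 2 / 5.

Lemma nf_vE : nf_v = w * nf_nu. Proof. by rewrite /nf_v /nf_nu; ring. Qed.
Lemma nf_uE : nf_u = U * nf_mu1 + w * nf_mu2.
Proof. by rewrite /nf_u /nf_v /nf_mu1 /nf_mu2 /nf_nu; ring. Qed.
End Remainders.

Section Params.
Variables (rho k : R).
Hypotheses (r0 : 0 < rho) (rk : rho ^+ 2 + k ^+ 2 = 1).

Let rn0 : rho != 0. Proof. by rewrite gt_eqF. Qed.
Let kap := k / rho.

(** Meant for the form of order 3, in which the constant sequence of the b_i stands for the single
    value b_3. *)
Definition nf_coefs : coefs R := Coefs
  (fun i j => match i, j with
    | 1, 1 => 3 / 4 | 0, 2 => 25 / 16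
    | 1, 2 => 125 / 64 * (k / rho) | 0, 3 => 9 * 125 / (4 * 64) * (k / rho)
    | _, _ => 0 end)
  (fun i => - (125 / 32 * (k / rho))).

Definition nf_phi (x : 'rV[R]_2) : 'rV[R]_2 :=
  \row_j [:: nf_u kap (x 0 0) (5 / 4 * x 0 1); nf_v kap (5 / 4 * x 0 1)]`_j.

(** The columns are e1, 4/5 e2 - 3/5 e3 and 3/5 e2 + 4/5 e3 at v = 0: the tangent line, the
    remaining direction, and the direction of gamma''(0). *)
Definition nf_A : 'M[R]_3 := \matrix_(i, j)
  (nth [::] [:: [:: rho; 3 / 5 * k; - (4 / 5) * k]; [:: 0; 4 / 5; 3 / 5];
                [:: k; - (3 / 5) * rho; 4 / 5 * rho]] i)`_j.

(** Minus the image under [nf_A] of the singular value [ruled rho k 0]. *)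
Definition nf_w : 'rV[R]_3 := row3 (4 / 5 * rho ^+ 3 * k)
  (- (12 / 25 * rho ^+ 2 * (1 - k ^+ 2))) (- (rho ^+ 2 * (9 / 25 + 16 / 25 * k ^+ 2))).

Lemma nf_A_orthogonal : nf_A *m nf_A^T = 1%:M.
Proof.
apply/matrixP => i j; move: i j; apply: forall_ord3; apply: forall_ord3;
  rewrite [LHS]mxE sum_ord3 !mxE /=.
- by apply: etrans rk; field.
- by field.
- by field.
- by field.
- by field.
- by field.
- by field.
- by field.
- by apply: etrans rk; field.
Qed.

Lemma nf_A_det : \det nf_A = 1.
Proof. by rewrite det_mx3 !mxE /=; apply: etrans rk; field. Qed.

Section Frame.
Variables (u v c s : R).
Let th := v / rho.
Let cosv := 1 - th ^+ 2 / 2 + th ^+ 4 * c.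
Let sinv := th * (1 - th ^+ 2 / 6 + th ^+ 4 * s).

(** The cofactors of v^4, with [c] and [s] standing for the quotients in the expansions of [cosq]
    and [sinq]. In [nf_f2] the quartic term v^3 u is kept apart, since it lacks a factor v^4. *)
Definition nf_R1 : R := (u - 4 / 5 * rho * k) * c / rho ^+ 3 + 2 / 15 * k / rho ^+ 2
  - (3 / 5 * rho + 4 / 5 * k * v) * v * s / rho ^+ 4.
Definition nf_R2 : R := (u - 4 / 5 * rho * k) * v * s / rho ^+ 4
  + (3 / 5 * rho + 4 / 5 * k * v) * c / rho ^+ 3.
Let a : R := - (6 * rho ^+ 2)^-1.

Lemma nf_f1 : rho * ((u - 4 / 5 * rho * k) * cosv - (3 / 5 * rho + 4 / 5 * k * v) * sinv)
  = rho * u - 4 / 5 * rho ^+ 2 * k - u * v ^+ 2 / (2 * rho) - 2 / 5 * k * v ^+ 2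
    - 3 / 5 * rho * v + v ^+ 3 / (10 * rho) + v ^+ 4 * nf_R1.
Proof. by rewrite /cosv /sinv /th /nf_R1; field. Qed.

Lemma nf_f2 : rho * ((u - 4 / 5 * rho * k) * sinv + (3 / 5 * rho + 4 / 5 * k * v) * cosv)
  = u * v + 3 / 5 * rho ^+ 2 - 3 / 10 * v ^+ 2 - 4 / 15 * kap * v ^+ 3
    + v ^+ 3 * u * a + v ^+ 4 * nf_R2.
Proof. by rewrite /cosv /sinv /th /nf_R2 /a /kap; field. Qed.
End Frame.

Lemma O4_of_factors (r g1 g2 : 'rV[R]_2 -> R) :
  Ck_on 0 setT g1 -> Ck_on 0 setT g2 ->
  (forall x, r x = x 0 0 * (5 / 4 * x 0 1) ^+ 3 * g1 x + (5 / 4 * x 0 1) ^+ 4 * g2 x) ->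
  exists K, \forall x \near (0 : 'rV[R]_2), `|r x| <= K * `|x| ^+ 4.
Proof.
move=> c1 c2 rE.
have bd (g : 'rV[R]_2 -> R) : Ck_on 0 setT g ->
    \forall x \near (0 : 'rV[R]_2), `|g x| <= `|g 0| + 1.
  move=> gc; have /cvgrPdist_le/(_ 1 ltr01) := gc 0 I.
  apply: filterS => x h; rewrite -[g x](subrK (g 0)) addrC.
  by apply: le_trans (ler_normD _ _) _; rewrite lerD2l distrC.
exists ((5 / 4) ^+ 3 * (`|g1 0| + 1) + (5 / 4) ^+ 4 * (`|g2 0| + 1)).
apply: filterS2 (bd _ c1) (bd _ c2) => x b1 b2.
have q n : 0 <= (5 / 4 : R) ^+ n by rewrite exprn_ge0.
have x0 := rV_norm_coord x 0; have x1 := rV_norm_coord x 1.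
rewrite rE; apply: le_trans (ler_normD _ _) _; rewrite [leRHS]mulrDl; apply: lerD.
  have -> : x 0 0 * (5 / 4 * x 0 1) ^+ 3 * g1 x = (5 / 4) ^+ 3 * g1 x * (x 0 0 * x 0 1 ^+ 3).
    by ring.
  rewrite normrM [`|_ * g1 x|]normrM (ger0_norm (q 3)); apply: ler_pM; rewrite ?mulr_ge0//.
  - by rewrite ler_wpM2l.
  - rewrite normrM normrX [`|x| ^+ 4]exprS; apply: ler_pM; rewrite ?exprn_ge0//.
    by rewrite lerXn2r ?nnegrE.
have -> : (5 / 4 * x 0 1) ^+ 4 * g2 x = (5 / 4) ^+ 4 * g2 x * (x 0 1 ^+ 4) by ring.
rewrite normrM [`|_ * g2 x|]normrM (ger0_norm (q 4)); apply: ler_pM; rewrite ?mulr_ge0//.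
- by rewrite ler_wpM2l.
- by rewrite normrX lerXn2r ?nnegrE.
Qed.

Lemma local_diffeo_nf_phi : local_diffeo nf_phi 0 /\ 0 < \det ('J nf_phi 0).
Proof.
have oT := @openT 'rV[R]_2.
have sT : smooth_on setT nf_phi.
  move=> n; apply: (Ck_on_rV oT).
  have p0 : Ck_on n setT (fun y : 'rV[R]_2 => y 0 0) by exact/(Ck_on_coord _ oT)/Ck_on_id.
  have p1 : Ck_on n setT (fun y : 'rV[R]_2 => y 0 1) by exact/(Ck_on_coord _ oT)/Ck_on_id.
  apply: forall_ord2.
    have : Ck_on n setT (fun y : 'rV[R]_2 => nf_u kap (y 0 0) (5 / 4 * y 0 1)).
      by rewrite /nf_u /nf_v; solve_Ck oT.
    by apply: (Ck_on_eq oT) => y _; rewrite mxE.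
  have : Ck_on n setT (fun y : 'rV[R]_2 => nf_v kap (5 / 4 * y 0 1)).
    by rewrite /nf_v; solve_Ck oT.
  by apply: (Ck_on_eq oT) => y _; rewrite mxE.
have dE : differentiable nf_phi 0 by have [d _] := sT 1%N; exact: d.
have ed (i j : 'I_2) (h : R) : (h *: delta_mx 0 i + 0 : 'rV[R]_2) 0 j = h * (j == i)%:R.
  by rewrite !mxE addr0.
have phiE y : (nf_phi y 0 0 = nf_u kap (y 0 0) (5 / 4 * y 0 1)) *
    (nf_phi y 0 1 = nf_v kap (5 / 4 * y 0 1)) by rewrite !mxE.
have J00 : 'J nf_phi 0 0 0 = 1.
  rewrite jacobianE// -(derive_coord _ _ dE).
  eapply is_derive_line => [h|]; first by rewrite phiE !ed /= !(mulr1, mulr0) /nf_u /nf_v; reflexivity.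
  by notypeclasses refine (is_derive_val _ _); [solve_derive|rewrite /=; field].
have J01 : 'J nf_phi 0 0 1 = 0.
  rewrite jacobianE// -(derive_coord _ _ dE).
  eapply is_derive_line => [h|]; first by rewrite phiE !ed /= !(mulr1, mulr0) /nf_u /nf_v; reflexivity.
  by notypeclasses refine (is_derive_val _ _); [solve_derive|rewrite /=; field].
have J11 : 'J nf_phi 0 1 1 = 5 / 4.
  rewrite jacobianE// -(derive_coord _ _ dE).
  eapply is_derive_line => [h|]; first by rewrite phiE !ed /= !(mulr1, mulr0) /nf_u /nf_v; reflexivity.
  by notypeclasses refine (is_derive_val _ _); [solve_derive|rewrite /=; field].
have dJ : \det ('J nf_phi 0) = 5 / 4 by rewrite det_mx2 J00 J01 J11 mul0r subr0 mul1r.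
split; last by rewrite dJ.
by apply: (inverse_function oT _ sT) => //; rewrite dJ.
Qed.

Lemma nf_residual (gc gs : R -> R) : continuous gc -> continuous gs ->
  (forall s, cosq s = 1 - s / 2 + s ^+ 2 * gc s) ->
  (forall s, sinq s = 1 - s / 6 + s ^+ 2 * gs s) ->
  forall j, exists g1 g2 : 'rV[R]_2 -> R, [/\ Ck_on 0 setT g1, Ck_on 0 setT g2 &
  forall x, (ruled rho k (nf_phi x) *m nf_A + nf_w - cubic_jet nf_coefs x) 0 j
    = x 0 0 * (5 / 4 * x 0 1) ^+ 3 * g1 x + (5 / 4 * x 0 1) ^+ 4 * g2 x].
Proof.
move=> cgc cgs gcE gsE.
have oT := @openT 'rV[R]_2.
pose U (x : 'rV[R]_2) : R := x 0 0.
pose w (x : 'rV[R]_2) : R := 5 / 4 * x 0 1.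
pose u x := nf_u kap (U x) (w x).
pose v x := nf_v kap (w x).
pose c x := gc ((v x / rho) ^+ 2).
pose s x := gs ((v x / rho) ^+ 2).
pose R1 x := nf_R1 (u x) (v x) (c x) (s x).
pose R2 x := nf_R2 (u x) (v x) (c x) (s x).
have UC : Ck_on 0 setT U by exact: (Ck_on_coord _ oT (Ck_on_id _ _)).
have wC : Ck_on 0 setT w.
  by apply: (Ck_onM oT); [exact: Ck_on_cst|exact: (Ck_on_coord _ oT (Ck_on_id _ _))].
have vC : Ck_on 0 setT v by rewrite /v /nf_v; solve_Ck oT.
have uC : Ck_on 0 setT u by rewrite /u /nf_u -/(v _); solve_Ck oT.
have thC : Ck_on 0 setT (fun x => (v x / rho) ^+ 2) by solve_Ck oT.
have cC : Ck_on 0 setT c.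
  by apply: (Ck_on_comp_R oT (E := setT)) thC _ => // x _; exact: cgc.
have sC : Ck_on 0 setT s.
  by apply: (Ck_on_comp_R oT (E := setT)) thC _ => // x _; exact: cgs.
have R1C : Ck_on 0 setT R1 by rewrite /R1 /nf_R1; solve_Ck oT.
have R2C : Ck_on 0 setT R2 by rewrite /R2 /nf_R2; solve_Ck oT.
pose a : R := - (6 * rho ^+ 2)^-1.
pose nu x := nf_nu kap (w x).
pose mu1 x := nf_mu1 (w x).
pose mu2 x := nf_mu2 kap (w x).
have nuC : Ck_on 0 setT nu by rewrite /nu /nf_nu; solve_Ck oT.
have mu1C : Ck_on 0 setT mu1 by rewrite /mu1 /nf_mu1; solve_Ck oT.
have mu2C : Ck_on 0 setT mu2 by rewrite /mu2 /nf_mu2 -/(nu _); solve_Ck oT.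
have vE x : v x = w x * nu x by exact: nf_vE.
have uE x : u x = U x * mu1 x + w x * mu2 x by exact: nf_uE.
(* [al] and [be] are the entries of the first two rows of [nf_A] in the column considered; the
   height is polynomial and brings no remainder of its own. *)
have comb (al be : R) (G H : R -> R) : Ck_on 0 setT (fun x => G (w x)) ->
    Ck_on 0 setT (fun x => H (w x)) ->
    exists g1 g2 : 'rV[R]_2 -> R, [/\ Ck_on 0 setT g1, Ck_on 0 setT g2 &
      forall x, U x * w x ^+ 3 * G (w x) + w x ^+ 4 * H (w x)
        + al * (v x ^+ 4 * R1 x) + be * (v x ^+ 3 * u x * a + v x ^+ 4 * R2 x)
      = x 0 0 * (5 / 4 * x 0 1) ^+ 3 * g1 x + (5 / 4 * x 0 1) ^+ 4 * g2 x].
  move=> GC HC.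
  exists (fun x => G (w x) + be * (nu x ^+ 3 * mu1 x * a)).
  exists (fun x => H (w x) + al * (nu x ^+ 4 * R1 x)
    + be * (nu x ^+ 3 * mu2 x * a + nu x ^+ 4 * R2 x)).
  split; [by solve_Ck oT|by solve_Ck oT|move=> x].
  rewrite vE uE -/(U x) -/(w x); move: (R1 x) (R2 x) (G _) (H _) => r1 r2 g h.
  by ring.
have f1 x : ruled rho k (nf_phi x) 0 0 = rho * u x - 4 / 5 * rho ^+ 2 * k
    - u x * v x ^+ 2 / (2 * rho) - 2 / 5 * k * v x ^+ 2
    - 3 / 5 * rho * v x + v x ^+ 3 / (10 * rho) + v x ^+ 4 * R1 x.
  rewrite /ruled row3E cos_cosq sin_sinq gcE gsE -nf_f1 -!exprM.
  by rewrite /nf_phi !mxE /= /c /s -/(w x) -/(U x) -/(u x) -/(v x).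
have f2 x : ruled rho k (nf_phi x) 0 1 = u x * v x + 3 / 5 * rho ^+ 2 - 3 / 10 * v x ^+ 2
    - 4 / 15 * kap * v x ^+ 3 + v x ^+ 3 * u x * a + v x ^+ 4 * R2 x.
  rewrite /ruled row3E cos_cosq sin_sinq gcE gsE -nf_f2 -!exprM.
  by rewrite /nf_phi !mxE /= /c /s -/(w x) -/(U x) -/(u x) -/(v x).
have f3 x : ruled rho k (nf_phi x) 0 2%:R = k * (u x - 3 / 5 * v x) + 2 / 5 * rho * v x ^+ 2.
  by rewrite /ruled row3E /nf_phi !mxE.
have comp x j : (ruled rho k (nf_phi x) *m nf_A + nf_w - cubic_jet nf_coefs x) 0 j
   = ruled rho k (nf_phi x) 0 0 * nf_A 0 j + ruled rho k (nf_phi x) 0 1 * nf_A 1 j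
     + ruled rho k (nf_phi x) 0 2%:R * nf_A 2%:R j + nf_w 0 j - cubic_jet nf_coefs x 0 j.
  by rewrite [LHS]mxE [X in X + _]mxE [X in X + _ + _]mxE sum_ord3 [X in _ + X = _]mxE.
apply: forall_ord3.
- have [|| g1 [g2 [c1 c2 E]]] := comb rho 0 (nf_GX kap) (nf_HX kap).
  + by rewrite /nf_GX; solve_Ck oT.
  + by rewrite /nf_HX; solve_Ck oT.
  exists g1, g2; split => // x; rewrite -E comp f1 f2 f3 /cubic_jet /nf_w !row3E !mxE /= -/(U x).
  have := nf_X kap (U x) (w x); rewrite -/(u x) -/(v x).
  move: (R1 x) (R2 x) (nf_GX _ _) (nf_HX _ _) => r1 r2 g h X.
  (* The constraint enters as a factor rho^2 + k^2 = 1, after which the goal is an identity in free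
     rho and k. *)
  have -> : U x * w x ^+ 3 * g + w x ^+ 4 * h = (u x - 3 / 5 * v x) * (rho ^+ 2 + k ^+ 2)
     - u x * v x ^+ 2 / 2 + v x ^+ 3 / 10 - U x by rewrite rk mulr1 X; ring.
  by field.
- have [|| g1 [g2 [c1 c2 E]]] := comb (3 / 5 * k) (4 / 5) (nf_GY kap) (nf_HY kap).
  + by rewrite /nf_GY; solve_Ck oT.
  + by rewrite /nf_HY; solve_Ck oT.
  exists g1, g2; split => // x; rewrite -E comp f1 f2 f3 /cubic_jet /nf_w !row3E !mxE /= -/(U x).
  have := nf_Y kap (U x) (w x); rewrite -/(u x) -/(v x).
  have -> : jety nf_coefs (U x) (x 0 1) = 4 / 5 * U x * w x - 1 / 3 * kap * w x ^+ 3.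
    by rewrite /jety /= -/kap /w; field.
  move: (R1 x) (R2 x) (nf_GY _ _) (nf_HY _ _) => r1 r2 g h X.
  have -> : U x * w x ^+ 3 * g + w x ^+ 4 * h =
     4 / 5 * (u x * v x - 3 / 10 * v x ^+ 2 - 4 / 15 * kap * v x ^+ 3)
     - 3 / 5 * (2 / 5 * v x ^+ 2 * (rho ^+ 2 + k ^+ 2)
       + kap * u x * v x ^+ 2 / 2 - kap * v x ^+ 3 / 10)
     - (4 / 5 * U x * w x - 1 / 3 * kap * w x ^+ 3) by rewrite rk mulr1 X; ring.
  by rewrite /kap; field.
- have [|| g1 [g2 [c1 c2 E]]] := comb (- (4 / 5) * k) (3 / 5) (nf_GZ kap) (nf_HZ kap).
  + by rewrite /nf_GZ; solve_Ck oT.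
  + by rewrite /nf_HZ; solve_Ck oT.
  exists g1, g2; split => // x; rewrite -E comp f1 f2 f3 /cubic_jet /nf_w !row3E !mxE /= -/(U x).
  have := nf_Z kap (U x) (w x); rewrite -/(u x) -/(v x).
  have -> : jetz nf_coefs (U x) (x 0 1) = 1 / 2 * w x ^+ 2 + 3 / 5 * U x * w x
      + 5 / 8 * kap * U x * w x ^+ 2 + 3 / 8 * kap * w x ^+ 3.
    by rewrite /jetz /jet2 /jet3 /= -/kap /w; field.
  move: (R1 x) (R2 x) (nf_GZ _ _) (nf_HZ _ _) => r1 r2 g h X.
  have -> : U x * w x ^+ 3 * g + w x ^+ 4 * h =
     3 / 5 * (u x * v x - 3 / 10 * v x ^+ 2 - 4 / 15 * kap * v x ^+ 3)
     + 4 / 5 * (2 / 5 * v x ^+ 2 * (rho ^+ 2 + k ^+ 2)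
       + kap * u x * v x ^+ 2 / 2 - kap * v x ^+ 3 / 10)
     - (1 / 2 * w x ^+ 2 + 3 / 5 * U x * w x + 5 / 8 * kap * U x * w x ^+ 2
       + 3 / 8 * kap * w x ^+ 3) by rewrite rk mulr1 X; ring.
  by rewrite /kap; field.
Qed.

Lemma ruled_normal_form : has_normal_form 3 (ruled rho k) 0 nf_coefs.
Proof.
have [phiD dphi] := local_diffeo_nf_phi.
split; first by rewrite /=.
exists nf_A, nf_w, nf_phi; split => //.
- by split; [exact: nf_A_orthogonal|exact: nf_A_det].
- split => //; apply/rowP; apply: forall_ord2; by rewrite !mxE /= /nf_u /nf_v; ring.
apply/eqO_exP.
have [gc cgc gcE] := cosq_expand R; have [gs cgs gsE] := sinq_expand R.
have res := nf_residual cgc cgs gcE gsE.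
have resK j : exists K, \forall x \near (0 : 'rV[R]_2),
    `|(ruled rho k (nf_phi x) *m nf_A + nf_w - cubic_jet nf_coefs x) 0 j| <= K * `|x| ^+ 4.
  by have [g1 [g2 [c1 c2 E]]] := res j; exact: O4_of_factors c1 c2 E.
have [K0 H0] := resK 0; have [K1 H1] := resK 1; have [K2 H2] := resK 2%:R.
have [K3 H3] := normal_jet_cubic nf_coefs (leqnn 3).
exists (`|K0| + `|K1| + `|K2| + `|K3| + 1); first by rewrite ltr_wpDl// !addr_ge0.
near=> x.
have x4 : 0 <= `|x| ^+ 4 by exact: exprn_ge0.
rewrite (ger0_norm x4).
have h0 : `|(ruled rho k (nf_phi x) *m nf_A + nf_w - cubic_jet nf_coefs x) 0 0| <= K0 * `|x| ^+ 4 by near: x.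
have h1 : `|(ruled rho k (nf_phi x) *m nf_A + nf_w - cubic_jet nf_coefs x) 0 1| <= K1 * `|x| ^+ 4 by near: x.
have h2 : `|(ruled rho k (nf_phi x) *m nf_A + nf_w - cubic_jet nf_coefs x) 0 2%:R| <= K2 * `|x| ^+ 4 by near: x.
have h3 : `|normal_jet 3 nf_coefs x - cubic_jet nf_coefs x| <= K3 * `|x| ^+ 4 by near: x.
have le (z K : R) : z <= K * `|x| ^+ 4 -> z <= `|K| * `|x| ^+ 4.
  by move=> h; apply: le_trans h _; rewrite ler_wpM2r// ler_norm.
have p (K : R) : 0 <= `|K| * `|x| ^+ 4 by rewrite mulr_ge0.
have hh : `|ruled rho k (nf_phi x) *m nf_A + nf_w - cubic_jet nf_coefs x|
    <= (`|K0| + `|K1| + `|K2|) * `|x| ^+ 4.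
  apply: rV_norm_le => [|j]; first by rewrite mulr_ge0// !addr_ge0.
  have pK0 := p K0; have pK1 := p K1; have pK2 := p K2.
  rewrite !mulrDl; move: j; apply: forall_ord3.
  - by apply: le_trans (le _ _ h0) _; rewrite -addrA lerDl addr_ge0.
  - by apply: le_trans (le _ _ h1) _; rewrite addrAC lerDr addr_ge0.
  - by apply: le_trans (le _ _ h2) _; rewrite lerDr addr_ge0.
have -> : ruled rho k (nf_phi x) *m nf_A + nf_w - normal_jet 3 nf_coefs x
  = (ruled rho k (nf_phi x) *m nf_A + nf_w - cubic_jet nf_coefs x)
    - (normal_jet 3 nf_coefs x - cubic_jet nf_coefs x).
  by rewrite opprB addrA subrK.
apply: le_trans (ler_normB _ _) _.
have := le _ _ h3; rewrite !mulrDl mul1r in hh *; lra.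
Unshelve. all: by end_near. Qed.
End Params.
End NormalForm.

(** * The isometric deformation and the variation of the invariants *)

Section Main.
Variable R : realType.

Lemma inv_value_ruled (rho k : R) : 0 < rho -> rho ^+ 2 + k ^+ 2 = 1 ->
  [/\ inv_value (Inv_a 1 2) (ruled rho k) 0 (125 / 64 * (k / rho)),
      inv_value (Inv_a 0 3) (ruled rho k) 0 (9 * 125 / (4 * 64) * (k / rho))
    & inv_value (Inv_b 3) (ruled rho k) 0 (- (125 / 32 * (k / rho)))].
Proof.
move=> r0 rk; have N := ruled_normal_form r0 rk.
split; split.
- by exists 3%N, (nf_coefs rho k).
- by move=> n c [n3 _ Nc] /=; have [_ <- _] := normal_form_unique (leqnn 3) n3 N Nc.
- by exists 3%N, (nf_coefs rho k).
- by move=> n c [n3 _ Nc] /=; have [_ _ <-] := normal_form_unique (leqnn 3) n3 N Nc.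
- by exists 3%N, (nf_coefs rho k).
- by move=> n c [n3 _ Nc] /=; have [<- _ _] := normal_form_unique (leqnn 3) n3 N Nc.
Qed.

(** The space is a union of segments issuing from the origin. *)
Lemma connected_rV n : connected [set: 'rV[R]_n].
Proof.
have -> : [set: 'rV[R]_n] = \bigcup_(x in setT) ((fun s : R => s *: x) @` `[0, 1]).
  apply/seteqP; split => // x _; exists x => //; exists 1; last by rewrite scale1r.
  by rewrite /= in_itv /= ler01 lexx.
apply: bigcup_connected.
  exists 0 => x _; exists 0; last by rewrite scale0r.
  by rewrite /= in_itv /= ler01 lexx.
move=> x _; apply: connected_continuous_connected; first exact: segment_connected.
apply: continuous_subspaceT => s; exact: scalel_continuous.
Qed.

Let cos_pos (t : R) : `|t| < 1 -> 0 < cos t.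
Proof.
have p2 := pi_ge2 R; rewrite ltr_norml => /andP[t1 t2].
by apply: cos_gt0_pihalf; apply/andP; split; lra.
Qed.

(** The bound 1 on |t| lies below pi/2, which keeps the radius cos t positive. *)
Lemma ruled_deformation :
  isometric_deformation 1 setT (fun t : R => ruled (cos t) (sin t)).
Proof.
have oT := @openT 'rV[R]_2.
split.
- exact: ltr01.
- by split => //; exact: connected_rV.
- set D := (X in smooth_on X).
  have oD : open D.
    have -> : D = (fun tx : R^o * 'rV[R]_2 => `|tx.1|) @^-1` [set r : R | r < 1].
      by apply/seteqP; split => [tx []|tx /=] //.
    apply: open_comp; last exact: open_lt.
    move=> tx _; apply: (@continuous_comp _ _ _ (fun tx : R^o * 'rV[R]_2 => tx.1) (fun r : R^o => `|r|)).
      exact: cvg_fst.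
    exact: norm_continuous.
  have fC n : Ck_on n D (fun tx : R^o * 'rV[R]_2 => tx.1 : R).
    have cf : continuous (fst : R^o * 'rV[R]_2 -> R^o) by move=> x; exact: cvg_fst.
    exact: (@Ck_on_lin R (R^o * 'rV[R]_2)%type R^o n D fst cf).
  have sC n : Ck_on n D (fun tx : R^o * 'rV[R]_2 => tx.2).
    have cs : continuous (snd : R^o * 'rV[R]_2 -> 'rV[R]_2) by move=> x; exact: cvg_snd.
    exact: (@Ck_on_lin R (R^o * 'rV[R]_2)%type _ n D snd cs).
  move=> n; apply: (Ck_on_ruled oD) => //.
  + by move=> tx [/cos_pos c _]; rewrite gt_eqF.
  + exact: Ck_on_cos.
  + exact: Ck_on_sin.
- move=> t /cos_pos c; split; first by apply: smooth_ruled; rewrite // gt_eqF.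
  by apply: cross_cap_ruled => //; exact: cos2Dsin2.
move=> t x /cos_pos c.
have c0 : 0 < cos (0 : R) by rewrite cos0.
have [a1 a2 a3] := ruled_metric c (cos2Dsin2 t) x.
have [b1 b2 b3] := ruled_metric c0 (cos2Dsin2 0) x.
by split; [exact: etrans a1 (esym b1)|exact: etrans a2 (esym b2)|exact: etrans a3 (esym b3)].
Qed.

(** Along the deformation the invariant is al tan t, which separates t = 0 from t = 1/2. *)
Lemma extrinsic_ruled (I : cc_invariant) (al : R) : al != 0 ->
  (forall rho k : R, 0 < rho -> rho ^+ 2 + k ^+ 2 = 1 ->
    inv_value I (ruled rho k) 0 (al * (k / rho))) ->
  extrinsic R I.
Proof.
move=> al0 H; exists 1, setT, (fun t : R => ruled (cos t) (sin t)).
split; first exact: ruled_deformation.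
have t2 : `|2^-1 : R| < 1 by rewrite ger0_norm ?invr_ge0// invf_lt1 ?ltr1n.
have t1 : `|0 : R| < 1 by rewrite normr0.
have c2 := cos_pos t2.
have s2 : 0 < sin (2^-1 : R).
  have p2 := pi_ge2 R.
  by apply: sin_gt0_pi; apply/andP; split; lra.
exists 0, 2^-1, (al * (sin 0 / cos 0)), (al * (sin 2^-1 / cos 2^-1)); split => //.
- by apply: H; [exact: cos_pos|exact: cos2Dsin2].
- by apply: H; [exact: cos_pos|exact: cos2Dsin2].
rewrite sin0 mul0r mulr0 => /esym/eqP.
by rewrite mulf_eq0 (negbTE al0) /= gt_eqF// divr_gt0.
Qed.
End Main.

Theorem theorem4 (R : realType) :
  [/\ extrinsic R (Inv_a 1 2), extrinsic R (Inv_a 0 3) & extrinsic R (Inv_b 3)].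
Proof.
split.
- apply: (@extrinsic_ruled R _ (125 / 64)) => [|rho k r0 rk]; last by have [] := inv_value_ruled r0 rk.
  by rewrite mulf_neq0.
- apply: (@extrinsic_ruled R _ (9 * 125 / (4 * 64))) => [|rho k r0 rk]; last by have [] := inv_value_ruled r0 rk.
  by rewrite !mulf_neq0// invr_eq0 mulf_neq0.
- apply: (@extrinsic_ruled R _ (- (125 / 32))) => [|rho k r0 rk]; last by rewrite mulNr; have [] := inv_value_ruled r0 rk.
  by rewrite oppr_eq0 mulf_neq0.
Qed.
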